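(* Let $R^i_t=\lambda^i(R)R^i_x$, $i=1,\dots,n$, be a semihamiltonian system, put $a_{ij}=\frac{\partial_j\lambda^i}{\lambda^j-\lambda^i}$ for $i\ne j$, let $h_t=g_x$ be a particular conservation law of this system, and fix an index $\alpha\in\{1,\dots,n\}$. Consider the system $$R^i_T=\Lambda^i(R)R^i_X,\qquad i=1,\dots,n,$$ with the characteristic velocities $$\Lambda^\alpha=\frac{g}{h},\qquad \Lambda^i=\frac{\lambda^i\,\partial_\alpha h-a_{i\alpha}\,g}{\partial_\alpha h-a_{i\alpha}\,h}\quad (i\neq\alpha).$$ Then the conservation laws $U_T=F_X$ of this new system are the $\mathcal L_\alpha$-transforms of the conservation laws $u_t=f_x$ of the system $R^i_t=\lambda^iR^i_x$, that is, the pairs $(U,F)$ of the form $$U=\mathcal L_\alpha(u)=u-\frac{h}{\partial_\alpha h}\,\partial_\alpha u,\qquad F=\mathcal L_\alpha(f)=f-\frac{g}{\partial_\alpha g}\,\partial_\alpha f .$$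
   Context: All functions are smooth functions of $R=(R^1,\dots,R^n)$, considered locally on a small simply connected domain, and $\partial_i=\partial/\partial R^i$. There is no summation over repeated indices. The characteristic velocities $\lambda^i$ are real and pairwise distinct. A conservation law $u_t=f_x$ of $R^i_t=\lambda^i(R)R^i_x$ is a pair of functions $u(R),f(R)$ with $\partial_if=\lambda^i\partial_iu$ for $i=1,\dots,n$; consequently $\partial_i\partial_ju=a_{ij}\partial_iu+a_{ji}\partial_ju$ for $i\neq j$. Conservation laws of the new system are defined in the same way with $\Lambda^i$ in place of $\lambda^i$. The system is called semihamiltonian if $\partial_ka_{ij}=a_{ik}a_{kj}+a_{ij}a_{jk}-a_{ij}a_{ik}$ for all pairwise distinct $i,j,k$. All expressions appearing in denominators ($h$, $\partial_\alpha h$, $\partial_\alpha g$, and $\partial_\alpha h-a_{i\alpha}h$ for $i\neq\alpha$) are assumed to be nowhere zero on the domain, and the new characteristic velocities $\Lambda^1,\dots,\Lambda^n$ are assumed to be pairwise distinct. *)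

(* Defs.v *)
(* The Riemann invariants (R^1, ..., R^n) form a row vector r : 'rV[R]_n. *)
From HB Require Import structures.
From mathcomp Require Import all_boot all_order all_algebra.
From mathcomp Require Import all_classical all_reals all_analysis.

Set Implicit Arguments.
Unset Strict Implicit.
Unset Printing Implicit Defensive.

Import Order.TTheory GRing.Theory Num.Theory.
Import numFieldNormedType.Exports.

Local Open Scope classical_set_scope.
Local Open Scope ring_scope.

Section SimplyConnected.
Context {R : realType} {T : topologicalType}.

(* Only the restriction of p to [0, 1] matters. *)
Definition path_in (D : set T) (p : R -> T) : Prop :=
  {within `[0, 1], continuous p} /\ p @` `[0, 1] `<=` D.

Definition path_connected (D : set T) : Prop :=
  forall x y, D x -> D y -> exists p, [/\ path_in D p, p 0 = x & p 1 = y].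

(* K (s, t) contracts the loop p (at s = 0) to its base point (at s = 1),
   keeping the base point fixed and staying inside D. *)
Definition null_homotopic (D : set T) (p : R -> T) : Prop :=
  exists K : R * R -> T,
    [/\ {within `[0, 1] `*` `[0, 1], continuous K},
        K @` (`[0, 1] `*` `[0, 1]) `<=` D,
        forall t, 0 <= t <= 1 -> K (0, t) = p t /\ K (1, t) = p 0
      & forall s, 0 <= s <= 1 -> K (s, 0) = p 0 /\ K (s, 1) = p 0].

Definition simply_connected (D : set T) : Prop :=
  path_connected D /\
  forall p, path_in D p -> p 0 = p 1 -> null_homotopic D p.

End SimplyConnected.

Arguments simply_connected R {T} D.

Section ConservationLaws.
Context {R : realType} {n : nat}.
Implicit Types (D : set 'rV[R]_n) (lam : 'I_n -> 'rV[R]_n -> R).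
Implicit Types (f g h u : 'rV[R]_n -> R).

Definition partial (i : 'I_n) f : 'rV[R]_n -> R :=
  fun r => 'D_(delta_mx 0 i) f r.

(* C^oo on the open set D: the iterated partial derivatives of all orders
   exist and are continuous at every point of D.  Functions are total, but
   since D is open their values outside D are irrelevant. *)
Definition smooth_on D f : Prop :=
  forall (s : seq 'I_n) r, D r ->
    {for r, continuous (foldr partial f s)} /\
    forall i, derivable (foldr partial f s) r (delta_mx 0 i).

(* (u, f) stands for u_t = f_x along the system R^i_t = lam^i R^i_x. *)
Definition conservation_law D lam u f : Prop :=
  [/\ smooth_on D u, smooth_on D f &
      forall i r, D r -> partial i f r = lam i r * partial i u r].

Definition pairwise_distinct D lam : Prop :=
  forall i j r, D r -> i != j -> lam i r != lam j r.

(* Meaningful only for i != j. *)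
Definition acoef lam (i j : 'I_n) : 'rV[R]_n -> R :=
  fun r => partial j (lam i) r / (lam j r - lam i r).

Definition semihamiltonian D lam : Prop :=
  let a := acoef lam in
  forall i j k, i != j -> i != k -> j != k -> forall r, D r ->
    partial k (a i j) r = a i k r * a k j r + a i j r * a j k r
                          - a i j r * a i k r.

Definition new_velocity lam h g (al i : 'I_n) : 'rV[R]_n -> R :=
  fun r =>
    if i == al then g r / h r
    else (lam i r * partial al h r - acoef lam i al r * g r)
         / (partial al h r - acoef lam i al r * h r).

(* L_al acts on a pair (u, f) with a different second argument on each
   component: U = Ltransform al h u and F = Ltransform al g f. *)
Definition Ltransform (al : 'I_n) h u : 'rV[R]_n -> R :=
  fun r => u r - h r / partial al h r * partial al u r.

End ConservationLaws.

(* Main.v *)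
Require Import Defs.
From HB Require Import structures.
From mathcomp Require Import all_boot all_order all_algebra.
From mathcomp Require Import all_classical all_reals all_analysis.
From mathcomp Require Import ring lra.

Set Implicit Arguments.
Unset Strict Implicit.
Unset Printing Implicit Defensive.

Import Order.TTheory GRing.Theory Num.Theory.
Import numFieldNormedType.Exports.

Local Open Scope classical_set_scope.
Local Open Scope ring_scope.

(** Write a_ij for the coefficients [acoef], h_i for the partial derivatives of
    h, p = d_al h, mu = g / h, and set c_al = 0 and
    c_i = p / (p - a_(i,al) h) for i != al ([weight]).  The new velocities then
    have the uniform expression Lam_i = mu + c_i (lam_i - mu), including i = al
    ([new_velocityE]).

    Given a conservation law (u, f), put w = d_al u / p.  Then
    U = L_al(u) = u - h w and F = L_al(f) = f - g w, and the second-order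
    equation d_i d_j u = a_ij d_i u + a_ji d_j u, valid for u and for h, yields
    d_i F = Lam_i d_i U directly ([transform_law]).

    Conversely, let (U, F) be a conservation law of the new system.  The equation
    U = L_al(u) says that v = u / h satisfies d_al v = U d_al(1/h), and the
    second-order equation for u then forces
      d_i v = c_i d_i U / h - U h_i / h^2      for every i.
    The 1-form on the right ([quotient_form]) involves U but not u.  It is closed:
    after multiplication by Lam_i - Lam_j, which does not vanish, closedness
    follows from the compatibility condition of dF = Lam dU and from
      (d_j c_i) c_j + c_i (1 - c_i) h_j / h + c_i (c_i - c_j) a_ij = 0
    ([weight_equation]), which is where the semihamiltonian property enters.  As
    the domain is simply connected, the form has a primitive v, and u = h v,
    f = F + g v - mu U is the required conservation law ([inverse_transform]).

    The exactness of closed forms on a simply connected open set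
    ([closed_form_exact]) is proved as follows.  Integration along segments
    gives a function I x y of two points.  For fixed x in a small ball,
    differentiation under the integral sign and closedness show that y |-> I x y
    is a primitive of the form, whence I x y + I y z = I x z for points of
    that ball ([segment_integral_cocycle]).  Such a local cocycle can be lifted
    along continuous maps from a rectangle to the domain, by subdivision of the
    rectangle ([liftable_rect]); a loop that bounds a homotopy therefore has no
    holonomy ([null_homotopic_lift]), and the cocycle is globally a coboundary
    ([cocycle_trivial]). *)

(** * Differentiation along lines and continuous differentiability *)

Section Lines.
Context {R : realType} {V : normedModType R}.
Implicit Types (f : V -> R) (x v : V).

Lemma is_derive_line f x v (t : R) : derivable f (x + t *: v) v ->
  is_derive t 1 (fun s : R => f (x + s *: v)) ('D_v f (x + t *: v)).
Proof.
move=> df.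
have E : (fun h : R => h^-1 *: (((fun s : R => f (x + s *: v)) \o shift t)
    (h *: (1 : R)) - f (x + t *: v))) =
    (fun h : R => h^-1 *: ((f \o shift (x + t *: v)) (h *: v) -
       f (x + t *: v))).
  apply/funext => h /=; congr (_ *: (f _ - _)).
  by rewrite scalerDl addrCA [h *: 1]mulr1.
by apply: DeriveDef; rewrite ?/derivable ?/derive E.
Qed.

(** Mean value theorem along a segment in direction v; the step a may have
    any sign. *)
Lemma MVT_line f x v (a : R) :
  (forall t, 0 <= t <= 1 -> derivable f (x + (t * a) *: v) v) ->
  exists2 t, 0 <= t <= 1 &
    f (x + a *: v) - f x = a * 'D_v f (x + (t * a) *: v).
Proof.
move=> df; have [->|a0] := eqVneq a 0.
  by exists 0; rewrite ?lexx ?ler01// scale0r addr0 subrr mul0r.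
pose g (s : R) := f (x + (s * a) *: v).
have dg (s : R) : 0 <= s <= 1 ->
    is_derive s 1 g (a * 'D_v f (x + (s * a) *: v)).
  move=> s01.
  rewrite mulrC; apply: (@is_derive1_comp _ (fun s => f (x + s *: v))
    (fun s => s * a)); first exact/is_derive_line/df.
  have := @is_deriveM _ _ (@id R) (cst a) s 1 1 0 _ _.
  by rewrite scaler0 add0r scaler1; apply.
have [|||t] := @MVT_segment _ g (fun s => a * 'D_v f (x + (s * a) *: v)) 0 1.
- exact: ler01.
- by move=> s; rewrite in_itv/= => /andP[s0 s1]; apply: dg; rewrite !ltW.
- apply: derivable_within_continuous => s; rewrite in_itv/= => s01.
  by have := dg s s01.
rewrite in_itv/= => t01 E; exists t => //.
by move: E; rewrite /g mul1r mul0r scale0r addr0 subr0 mulr1.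
Qed.

End Lines.

Lemma near_normP {R : realType} {V : normedModType R} (c : V) (P : V -> Prop) :
  (\forall r \near c, P r) -> exists2 d : R, 0 < d &
    forall r, `|r - c| < d -> P r.
Proof.
by move/nbhs_normP => [d d0 dP]; exists d => // r rc; apply: dP; rewrite /= distrC.
Qed.

Lemma norm_nearP {R : realType} {V : normedModType R} (c : V) (P : V -> Prop)
    (d : R) : 0 < d -> (forall r, `|r - c| < d -> P r) ->
  \forall r \near c, P r.
Proof.
by move=> d0 dP; apply/nbhs_normP; exists d => // r /= rc; apply: dP; rewrite distrC.
Qed.

Lemma filter_and {T : Type} {F : set_system T} {FF : Filter F} (P Q : T -> Prop) :
  (\forall x \near F, P x) -> (\forall x \near F, Q x) ->
  \forall x \near F, P x /\ Q x.
Proof. exact: filterI. Qed.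

Section C1.
Context {R : realType} {n : nat}.
Implicit Types (f : 'rV[R]_n -> R) (c w : 'rV[R]_n).

Lemma coord_le_norm (w : 'rV[R]_n) i : `|w 0 i| <= `|w|.
Proof.
rewrite [X in _ <= X]/Num.norm/= mx_normrE.
exact: (le_bigmax _ (fun i : 'I_1 * 'I_n => `|w i.1 i.2|) (0, i)).
Qed.

Lemma row_norm_le (w : 'rV[R]_n) (e : R) :
  0 <= e -> (forall i, `|w 0 i| <= e) -> `|w| <= e.
Proof.
move=> e0 we; rewrite [X in X <= _]/Num.norm/= mx_normrE.
by apply: bigmax_le => //= -[i j] _ /=; rewrite ord1.
Qed.

Lemma delta_norm_le1 (i : 'I_n) : `|delta_mx 0 i : 'rV[R]_n| <= 1.
Proof.
apply: row_norm_le => // j; rewrite mxE eqxx/=.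
by case: (j == i); rewrite ?normr1 ?normr0.
Qed.

Lemma ball_convex (c x y : 'rV[R]_n) (e t : R) : `|x - c| < e -> `|y - c| < e ->
  0 <= t <= 1 -> `|x + t *: (y - x) - c| < e.
Proof.
move=> xc yc /andP[t0 t1].
have -> : x + t *: (y - x) - c = (1 - t) *: (x - c) + t *: (y - c).
  by apply/rowP => k; rewrite !mxE; ring.
rewrite (le_lt_trans (ler_normD _ _))// !normrZ (ger0_norm t0).
rewrite ger0_norm ?subr_ge0//.
have -> : e = (1 - t) * e + t * e by ring.
have [->|tn] := eqVneq t 0; first by rewrite subr0 !mul1r !mul0r !addr0.
by rewrite ler_ltD ?ler_wpM2l ?subr_ge0// 1?ltW// ltr_pM2l// lt0r tn.
Qed.

(** Partial derivatives that exist near c and are continuous at c make f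
    Frechet differentiable at c.  The candidate differential is L; the increment
    of f is telescoped along the coordinate axes, each step being handled by the
    mean value theorem. *)
Lemma differentiable_partials f c :
  (\forall r \near c, forall i, derivable f r (delta_mx 0 i)) ->
  (forall i, {for c, continuous (partial i f)}) -> differentiable f c.
Proof.
move=> df cf.
pose L w := \sum_i w 0 i * partial i f c.
have Llin : linear L.
  move=> k u v; rewrite /L scaler_sumr -big_split/=; apply: eq_bigr => i _.
  by rewrite !mxE mulrDl -mulrA.
pose LM := GRing.isLinear.Build _ _ _ _ L Llin.
pose LL : {linear 'rV[R]_n -> R} := HB.pack L LM.
have Lc : continuous LL.
  apply: (@continuous_big R _ +%R 0 xpredT (@add_continuous R^o)) => i _ w.
  exact: (cvgM (@coord_continuous _ _ _ 0 i w) (cvg_cst _)).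
suff /eqaddoP E : forall e : R, 0 < e -> \forall w \near (0 : 'rV[R]_n),
    `|(f \o shift c - (cst (f c) + LL) : 'rV[R]_n -> R^o) w| <= e * `|w|.
  by apply/diff_locallyP; rewrite (diff_unique Lc E).
move=> e e0.
have en0 : 0 < e / n.+1%:R by rewrite divr_gt0.
have cf' : \forall r \near c, forall i,
    `|partial i f c - partial i f r| <= e / n.+1%:R.
  apply: (@filter_forall _ _
    (fun i r => `|partial i f c - partial i f r| <= e / n.+1%:R) (nbhs c)) => i.
  by have /cvgrPdist_le/(_ _ en0) := cf i.
have [d d0 dP] : exists2 d : R, 0 < d & forall r, `|r - c| <= d ->
    (forall i, derivable f r (delta_mx 0 i)) /\
    forall i, `|partial i f c - partial i f r| <= e / n.+1%:R.
  have [d d0 dP] := near_normP (filter_and df cf').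
  exists (d / 2) => [|r rc]; first by rewrite divr_gt0.
  by apply: dP; rewrite (le_lt_trans rc)// ltr_pdivrMr// ltr_pMr// ltr1n.
apply: (norm_nearP d0) => w; rewrite subr0 => /ltW wd.
rewrite [X in `|X|](_ : _ = f (w + c) - f c - L w); last by rewrite -addrA -opprD.
(* W k keeps the first k coordinates of w, so W 0 = 0 and W n = w. *)
pose W (k : nat) : 'rV[R]_n := \row_i (if (i < k)%N then w 0 i else 0).
have W0 : W 0%N = 0 by apply/rowP => i; rewrite !mxE.
have Wn : W n = w by apply/rowP => i; rewrite !mxE ltn_ord.
have WS (k : 'I_n) : W k.+1 = W k + w 0 k *: delta_mx 0 k.
  apply/rowP => i; rewrite !mxE eqxx/= ltnS leq_eqVlt.
  have [->|ik] /= := eqVneq i k; first by rewrite eqxx ltnn mulr1 add0r.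
  by rewrite -val_eqE in ik; rewrite (negbTE ik)/= mulr0 addr0.
have -> : f (w + c) - f c = \sum_(k < n) (f (c + W k.+1) - f (c + W k)).
  rewrite -(big_mkord xpredT (fun k => f (c + W k.+1) - f (c + W k))).
  by rewrite (telescope_sumr (fun k => f (c + W k)))// Wn W0 addr0 (addrC c).
rewrite /L -sumrB (le_trans (ler_norm_sum _ _ _))//.
apply: (@le_trans _ _ (\sum_(k < n) e / n.+1%:R * `|w|)); last first.
  rewrite sumr_const card_ord -[leLHS]mulr_natl mulrA ler_wpM2r// mulrCA ger_pMr//.
  by rewrite ler_pdivrMr// mul1r ler_nat.
apply: ler_sum => k _.
have near_c (t : R) : 0 <= t <= 1 ->
   `|c + W k + (t * w 0 k) *: delta_mx 0 k - c| <= d.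
  move=> /andP[t0 t1]; apply: le_trans wd.
  rewrite -(addrA c) (addrC c) addrK; apply: row_norm_le => // i.
  rewrite !mxE eqxx/=.
  have [->|ik] := eqVneq i k.
    rewrite ltnn add0r mulr1 normrM (ger0_norm t0).
    by rewrite (le_trans _ (coord_le_norm w k))// ler_piMl.
  rewrite mulr0 addr0; case: ifP => _; first exact: coord_le_norm.
  by rewrite normr0.
have [t t01] := @MVT_line _ _ f (c + W k) (delta_mx 0 k) (w 0 k)
  (fun t t01 => (dP _ (near_c t t01)).1 k).
rewrite -addrA -WS => ->; rewrite -mulrBr normrM mulrC.
rewrite ler_pM//; last exact: coord_le_norm.
by rewrite distrC; have [_] := dP _ (near_c t t01); apply.
Qed.

End C1.

Section DeriveRules.
Context {R : realType} {V : normedModType R}.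
Implicit Types (f g : V -> R) (r v w : V).

Lemma deriv_add f g r v df dg : is_derive r v f df -> is_derive r v g dg ->
  is_derive r v (fun x => f x + g x) (df + dg).
Proof. by move=> ? ?; exact: is_deriveD. Qed.

Lemma deriv_sub f g r v df dg : is_derive r v f df -> is_derive r v g dg ->
  is_derive r v (fun x => f x - g x) (df - dg).
Proof. by move=> ? ?; exact: is_deriveB. Qed.

Lemma deriv_mul f g r v df dg : is_derive r v f df -> is_derive r v g dg ->
  is_derive r v (fun x => f x * g x) (df * g r + f r * dg).
Proof.
move=> fd gd; apply: (@is_derive_eq _ _ _ _ _ _ _ _ (is_deriveM fd gd)).
by rewrite addrC; congr (_ + _); exact: mulrC.
Qed.

Lemma deriv_inv f r v df : f r != 0 -> is_derive r v f df ->
  is_derive r v (fun x => (f x)^-1) (- df / f r ^+ 2).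
Proof.
move=> f0 fd; apply: DeriveDef; first by apply: derivableV => //; case: fd.
rewrite deriveV//.
by rewrite derive_val -[LHS]/(- f r ^- 2 * df) !mulNr mulrC.
Qed.

Lemma deriv_div f g r v df dg : g r != 0 ->
  is_derive r v f df -> is_derive r v g dg ->
  is_derive r v (fun x => f x / g x) ((df * g r - f r * dg) / g r ^+ 2).
Proof.
move=> g0 fd gd; apply: (@is_derive_eq _ _ _ _ _ _ _ _
  (deriv_mul fd (deriv_inv g0 gd))).
by field.
Qed.

Lemma deriv_shift f r v w : derivable f (r + w) v ->
  is_derive r v (fun x => f (x + w)) ('D_v f (r + w)).
Proof.
move=> df.
have E : (fun h : R => h^-1 *: (((fun x => f (x + w)) \o shift r)
    (h *: v) - f (r + w))) =
    (fun h : R => h^-1 *: ((f \o shift (r + w)) (h *: v) - f (r + w))).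
  by apply/funext => h /=; congr (_ *: (f _ - _)); rewrite addrA.
by apply: DeriveDef; rewrite ?/derivable ?/derive E.
Qed.

End DeriveRules.

Lemma half_quarter {R : realFieldType} (d : R) : 0 < d ->
  2 * (d / 4) <= d / 2 /\ d / 2 < d.
Proof. by move=> d0; split; lra. Qed.

Lemma dist_half {R : realFieldType} (a b x e : R) :
  `|a - x| < e / 2 -> `|b - x| < e / 2 -> `|a - b| < e.
Proof. by rewrite !ltr_norml => /andP[? ?] /andP[? ?]; lra. Qed.

Lemma sub_subAC {R : comRingType} (a b c d : R) :
  a - b - (c - d) = a - c - (b - d).
Proof. by ring. Qed.

(** * Smooth functions on an open set *)

Section Smooth.
Context {R : realType} {n : nat} (D : set 'rV[R]_n).
Hypothesis oD : open D.
Implicit Types (f g : 'rV[R]_n -> R) (i j : 'I_n).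

Lemma smooth_partial f i : smooth_on D f -> smooth_on D (partial i f).
Proof. by move=> sf s r Dr; have := sf (rcons s i) r Dr; rewrite foldr_rcons. Qed.

Lemma smooth_continuous f r : smooth_on D f -> D r -> {for r, continuous f}.
Proof. by move=> sf Dr; have [] := sf [::] r Dr. Qed.

Lemma smooth_is_derive f r i : smooth_on D f -> D r ->
  is_derive r (delta_mx 0 i) f (partial i f r).
Proof. by move=> sf Dr; have [_ df] := sf [::] r Dr; exact: derivableP. Qed.

Lemma open_near r : D r -> \forall x \near r, D x.
Proof. by move=> Dr; exact: open_nbhs_nbhs. Qed.

Lemma differentiable_on f :
  (forall r, D r -> forall i, derivable f r (delta_mx 0 i)) ->
  (forall r, D r -> forall i, {for r, continuous (partial i f)}) ->
  forall r, D r -> differentiable f r.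
Proof.
move=> df cf r Dr; apply: differentiable_partials; last exact: cf.
by apply: filterS (open_near Dr) => x /df.
Qed.

Lemma smooth_differentiable f r : smooth_on D f -> D r -> differentiable f r.
Proof.
move=> sf; move: r; apply: differentiable_on => r Dr i.
  by have [] := smooth_is_derive i sf Dr.
exact: smooth_continuous (smooth_partial i sf) Dr.
Qed.

Lemma derive_partials f r v : differentiable f r ->
  'D_v f r = \sum_i v 0 i * partial i f r.
Proof.
move=> df; rewrite deriveE// {1}(row_sum_delta v) linear_sum/=.
by apply: eq_bigr => i _; rewrite linearZ/= /partial deriveE.
Qed.

Lemma partial_ext f g i r : D r -> {in D, f =1 g} -> partial i f r = partial i g r.
Proof.
move=> Dr fg; apply: near_eq_derive.
by apply: filterS (open_near Dr) => x Dx; apply: fg; rewrite inE.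
Qed.

(** C^k functions on D, by recursion on k; [Ck 0] is no condition at all, since
    only the conjunction over all k matters ([smooth_CkP]).  It allows closure
    properties of smooth functions to be proved by induction on k. *)
Fixpoint Ck (k : nat) f : Prop :=
  if k is k'.+1 then
    (forall r, D r -> {for r, continuous f} /\
       forall i, derivable f r (delta_mx 0 i)) /\
    forall i, Ck k' (partial i f)
  else True.

Lemma smooth_CkP f : smooth_on D f <-> forall k, Ck k f.
Proof.
split=> [sf k|].
  elim: k f sf => //= k IH f sf; split=> [r Dr|i]; first exact: (sf [::]).
  exact: IH (smooth_partial i sf).
move=> cf s r Dr; move: cf; elim/last_ind: s f => [|s i IH] f cf.
  by have [/(_ _ Dr)] := cf 1%N.
by rewrite foldr_rcons; apply: IH => k; have [_ /(_ i)] := cf k.+1.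
Qed.

Lemma CkS k f : Ck k.+1 f -> Ck k f.
Proof.
elim: k f => //= k IH f [cf pf]; split=> // i; exact/IH/pf.
Qed.

Lemma Ck_is_derive k f r i : Ck k.+1 f -> D r ->
  is_derive r (delta_mx 0 i) f (partial i f r).
Proof. by move=> [/(_ r)] + _ Dr => /(_ Dr)[_ /(_ i)] df; exact: derivableP. Qed.

Lemma Ck_ext k f g : {in D, f =1 g} -> Ck k f -> Ck k g.
Proof.
elim: k f g => //= k IH f g fg [cf pf].
have fgr r : D r -> \forall x \near r, f x = g x.
  by move=> Dr; apply: filterS (open_near Dr) => x Dx; apply: fg; rewrite inE.
split=> [r Dr|i].
  have [cr dr] := cf _ Dr; split=> [|i].
    rewrite /prop_for /continuous_at -(fg r) ?inE//.
    by apply: cvg_trans cr; apply: (@near_eq_cvg _ _ (nbhs r)); exact: fgr.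
  by apply: near_eq_derivable (dr i); exact: fgr.
apply: IH (pf i) => r; rewrite inE => Dr; exact: partial_ext.
Qed.

(** The partial derivatives may be given by any functions that agree with them
    on D. *)
Lemma Ck_intro k f (df : 'I_n -> 'rV[R]_n -> R) :
  (forall r, D r -> {for r, continuous f}) ->
  (forall i r, D r -> is_derive r (delta_mx 0 i) f (df i r)) ->
  (forall i, Ck k (df i)) -> Ck k.+1 f.
Proof.
move=> cf fd kd; split=> [r Dr|i].
  by split=> [|i]; [exact: cf|have [] := fd i r Dr].
apply: Ck_ext (kd i) => r; rewrite inE => Dr.
by have [_ E] := fd i r Dr; rewrite -E.
Qed.

Lemma Ck_cst k c : Ck k (fun=> c).
Proof.
elim: k c => // k IH c; apply: (@Ck_intro _ _ (fun _ _ => 0)) => //.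
by move=> r _; exact: cst_continuous.
Qed.

Lemma Ck_add k f g : Ck k f -> Ck k g -> Ck k (fun r => f r + g r).
Proof.
elim: k f g => // k IH f g cf cg.
apply: (@Ck_intro _ _ (fun i r => partial i f r + partial i g r)).
- move=> r Dr; have [cfr _] := cf.1 r Dr; have [cgr _] := cg.1 r Dr.
  exact: (cvgD cfr cgr).
- by move=> i r Dr; exact: deriv_add (Ck_is_derive i cf Dr) (Ck_is_derive i cg Dr).
- by move=> i; apply: IH; [exact: cf.2|exact: cg.2].
Qed.

Lemma Ck_mul k f g : Ck k f -> Ck k g -> Ck k (fun r => f r * g r).
Proof.
elim: k f g => // k IH f g cf cg.
apply: (@Ck_intro _ _ (fun i r => partial i f r * g r + f r * partial i g r)).
- move=> r Dr; have [cfr _] := cf.1 r Dr; have [cgr _] := cg.1 r Dr.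
  exact: (cvgM cfr cgr).
- by move=> i r Dr; exact: deriv_mul (Ck_is_derive i cf Dr) (Ck_is_derive i cg Dr).
- move=> i; apply: Ck_add; apply: IH.
  + exact: cf.2.
  + exact: CkS.
  + exact: CkS.
  + exact: cg.2.
Qed.

Lemma Ck_inv k f : (forall r, D r -> f r != 0) -> Ck k f ->
  Ck k (fun r => (f r)^-1).
Proof.
move=> f0; elim: k => // k IH cf.
apply: (@Ck_intro _ _ (fun i r => (-1) * partial i f r * ((f r)^-1 * (f r)^-1))).
- move=> r Dr; have [cfr _] := cf.1 r Dr.
  exact: (cvgV (f0 _ Dr) cfr).
- move=> i r Dr; apply: (@is_derive_eq _ _ _ _ _ _ _ _
    (deriv_inv (f0 _ Dr) (Ck_is_derive i cf Dr))).
  by rewrite mulN1r -invfM.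
- move=> i; apply: Ck_mul; last by apply: Ck_mul; apply/IH/CkS.
  by apply: Ck_mul; [exact: Ck_cst|exact: cf.2].
Qed.

Lemma smooth_ext f g : {in D, f =1 g} -> smooth_on D f -> smooth_on D g.
Proof. by move=> fg /smooth_CkP cf; apply/smooth_CkP => k; exact: Ck_ext (cf k). Qed.

Lemma smooth_add f g : smooth_on D f -> smooth_on D g ->
  smooth_on D (fun r => f r + g r).
Proof. by move=> /smooth_CkP cf /smooth_CkP cg; apply/smooth_CkP => k; exact: Ck_add. Qed.

Lemma smooth_mul f g : smooth_on D f -> smooth_on D g ->
  smooth_on D (fun r => f r * g r).
Proof. by move=> /smooth_CkP cf /smooth_CkP cg; apply/smooth_CkP => k; exact: Ck_mul. Qed.

Lemma smooth_opp f : smooth_on D f -> smooth_on D (fun r => - f r).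
Proof.
move=> /smooth_CkP cf; apply/smooth_CkP => k.
apply: (@Ck_ext k (fun r => (-1) * f r)) => [r _|]; first by rewrite mulN1r.
by apply: Ck_mul; [exact: Ck_cst|].
Qed.

Lemma smooth_sub f g : smooth_on D f -> smooth_on D g ->
  smooth_on D (fun r => f r - g r).
Proof. by move=> sf sg; exact: smooth_add sf (smooth_opp sg). Qed.

Lemma smooth_div f g : (forall r, D r -> g r != 0) ->
  smooth_on D f -> smooth_on D g -> smooth_on D (fun r => f r / g r).
Proof.
move=> g0 sf /smooth_CkP cg; apply: (smooth_mul sf).
by apply/smooth_CkP => k; exact: Ck_inv.
Qed.

(** A continuous function whose partial derivatives on D are smooth is smooth. *)
Lemma smooth_primitive f (w : 'I_n -> 'rV[R]_n -> R) :
  (forall r, D r -> {for r, continuous f}) ->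
  (forall i r, D r -> is_derive r (delta_mx 0 i) f (w i r)) ->
  (forall i, smooth_on D (w i)) -> smooth_on D f.
Proof.
move=> cf fd sw; apply/smooth_CkP => -[//|k]; apply: (@Ck_intro _ _ w) => // i.
by move/smooth_CkP: (sw i).
Qed.

Let e i : 'rV[R]_n := delta_mx 0 i.

(** The second difference of f over a small square spanned by e_i and e_j is
    a^2 times a mixed derivative at some point of the square. *)
Let second_difference f i j r (d a : R) : smooth_on D f -> 0 < a ->
  2 * a <= d -> (forall x, `|x - r| <= d -> D x) ->
  exists2 q, `|q - r| <= d &
    f (r + a *: e i + a *: e j) - f (r + a *: e i) - (f (r + a *: e j) - f r)
    = a * (a * partial j (partial i f) q).
Proof.
move=> sf a0 ad Dd.
have inD (s t : R) : 0 <= s <= 1 -> 0 <= t <= 1 ->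
    `|r + (s * a) *: e i + (t * a) *: e j - r| <= d.
  move=> /andP[s0 s1] /andP[t0 t1]; rewrite -(addrA r) (addrC r) addrK.
  have -> : d = a + a + (d - 2 * a) by ring.
  rewrite (le_trans (ler_normD _ _))// -[leLHS]addr0 lerD ?subr_ge0//.
  have B (u : R) k : 0 <= u -> u <= 1 -> `|(u * a) *: e k| <= a.
    move=> u0 u1; rewrite normrZ ger0_norm ?mulr_ge0 ?(ltW a0)//.
        apply: (@le_trans _ _ (u * a * 1)).
      by rewrite ler_wpM2l ?delta_norm_le1// mulr_ge0// ltW.
    by rewrite mulr1 ler_piMl// ltW.
  by apply: lerD; exact: B.
have t1 : 0 <= (1 : R) <= 1 by rewrite ler01 lexx.
have t0 : 0 <= (0 : R) <= 1 by rewrite ler01 lexx.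
pose phi x := f (x + a *: e j) - f x.
have dphi (t : R) : 0 <= t <= 1 ->
    is_derive (r + (t * a) *: e i) (e i) phi
      (partial i f (r + (t * a) *: e i + a *: e j)
       - partial i f (r + (t * a) *: e i)).
  move=> t01; apply: deriv_sub.
    apply: deriv_shift.
    have := inD t 1 t01 t1; rewrite mul1r => /Dd Dx.
    by have [] := smooth_is_derive i sf Dx.
  apply: smooth_is_derive => //; apply: Dd.
  by have := inD t 0 t01 t0; rewrite mul0r scale0r addr0.
have [|t t01] := @MVT_line _ _ phi r (e i) a.
  by move=> t t01; have [] := dphi t t01.
rewrite /phi addrAC => ->.
have [_ ->] := dphi t t01.
have [|s s01] := @MVT_line _ _ (partial i f) (r + (t * a) *: e i) (e j) a.
  move=> s s01.
  by have [] := smooth_is_derive j (smooth_partial i sf) (Dd _ (inD t s t01 s01)).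
move=> ->; exists (r + (t * a) *: e i + (s * a) *: e j) => //.
exact: inD.
Qed.

(** Symmetry of second derivatives: the second difference does not depend on
    the order of the two directions, so the two mixed derivatives agree at
    points arbitrarily close to r. *)
Lemma partialC f i j r : smooth_on D f -> D r ->
  partial i (partial j f) r = partial j (partial i f) r.
Proof.
move=> sf Dr; apply/eqP/negPn/negP => neq.
set A := partial i (partial j f) r; set B := partial j (partial i f) r.
have eps0 : 0 < `|A - B| / 2 by rewrite divr_gt0// normr_gt0 subr_eq0.
have cA := smooth_continuous (smooth_partial i (smooth_partial j sf)) Dr.
have cB := smooth_continuous (smooth_partial j (smooth_partial i sf)) Dr.
move/cvgrPdist_lt/(_ _ eps0) : cA => nA.
move/cvgrPdist_lt/(_ _ eps0) : cB => nB.
have [d d0 dP] := near_normP (filter_and (open_near Dr) (filter_and nA nB)).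
have d20 : 0 < d / 2 by rewrite divr_gt0.
have a0 : 0 < d / 4 by rewrite divr_gt0.
have ad : 2 * (d / 4) <= d / 2 by have [] := half_quarter d0.
have lt2 (x : 'rV[R]_n) : `|x - r| <= d / 2 -> `|x - r| < d.
  by move=> /le_lt_trans; apply; have [] := half_quarter d0.
have Dd x : `|x - r| <= d / 2 -> D x by move=> /lt2/dP[].
have [q qd Eq] := second_difference i j sf a0 ad Dd.
have [q' qd' Eq'] := second_difference j i sf a0 ad Dd.
have /(mulfI (lt0r_neq0 a0))/(mulfI (lt0r_neq0 a0)) E :
    d / 4 * (d / 4 * partial j (partial i f) q) =
    d / 4 * (d / 4 * partial i (partial j f) q').
  have PP : r + (d / 4) *: e i + (d / 4) *: e j =
    r + (d / 4) *: e j + (d / 4) *: e i := addrAC _ _ _.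
  apply: etrans (esym Eq) _.
  apply: etrans _ Eq'.
  rewrite PP.
  exact: sub_subAC.
have [_ [_ HB]] := dP _ (lt2 _ qd).
have [_ [HA _]] := dP _ (lt2 _ qd').
rewrite -E in HA.
by have := dist_half HA HB; rewrite ltxx.
Qed.

Lemma zero_partials_ball f c (d : R) x y :
  (forall r, `|r - c| < d -> differentiable f r /\ forall i, partial i f r = 0) ->
  `|x - c| < d -> `|y - c| < d -> f x = f y.
Proof.
move=> df xd yd.
have seg (t : R) : 0 <= t <= 1 -> `|x + (t * 1) *: (y - x) - c| < d.
  by move=> t01; rewrite mulr1; exact: ball_convex.
have [|t t01] := @MVT_line _ _ f x (y - x) 1.
  by move=> t t01; apply: diff_derivable; have [] := df _ (seg t t01).
have [dif p0] := df _ (seg t t01).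
rewrite derive_partials// big1 => [|i _]; last by rewrite p0 mulr0.
by rewrite mulr0 scale1r (addrC x) subrK => /subr0_eq.
Qed.

End Smooth.

(** * Cousin's lemma *)

Section Cousin.
Context {R : realType}.

(** Cousin's lemma: a property of subintervals of [l, r] that holds for all
    sufficiently small intervals around each point, and for the union of two
    adjacent intervals when it holds for both, holds for [l, r]. *)
Lemma cousin (P : R -> R -> Prop) (l r : R) : l <= r ->
  (forall x, l <= x <= r -> exists2 e : R, 0 < e & forall a b,
     l <= a -> a <= x -> x <= b -> b <= r -> b - a < e -> P a b) ->
  (forall a b c, l <= a -> a <= b -> b <= c -> c <= r ->
     P a b -> P b c -> P a c) ->
  P l r.
Proof.
move=> lr loc glue.
pose S := [set x | l <= x <= r /\ P l x].
have Sl : S l.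
  split; first by rewrite lexx lr.
  have [|e e0 H] := loc l; first by rewrite lexx lr.
  by apply: H; rewrite ?lexx// subrr.
have hS : has_sup S by split; [exists l|exists r => x [/andP[]]].
have lS : l <= sup S by exact: ub_le_sup hS.2 _ Sl.
have Sr : sup S <= r by apply: ge_sup; [exists l|move=> x [/andP[]]].
have [|e e0 H] := loc (sup S); first by rewrite lS.
have e20 : 0 < e / 2 by rewrite divr_gt0.
(* From a point x of S close to sup S, local validity around sup S reaches
   beyond sup S unless the endpoint r is met first. *)
have [x [/andP[lx xr] Px] xS] := sup_adherent e20 hS.
have xleS : x <= sup S by apply: ub_le_sup hS.2 _ _; split=> //; rewrite lx.
pose b := Num.min r (sup S + e / 3).
have Sb : sup S <= b by rewrite le_min Sr lerDl divr_ge0// ltW.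
have br : b <= r by rewrite ge_min lexx.
have bS : b <= sup S + e / 3 by rewrite ge_min lexx orbT.
have Pb : P l b.
  apply: (glue l x b) => //; first exact: le_trans Sb.
  by apply: H => //; lra.
have : S b by split=> //; rewrite (le_trans lS Sb) br.
move=> /(ub_le_sup hS.2) bleS.
suff <- : b = r by [].
move: bleS; rewrite /b; case: (leP r (sup S + e / 3)) => // _.
by rewrite gerDl leNgt divr_gt0.
Qed.

Lemma locally_constant (f : R -> R) (l r : R) : l <= r ->
  (forall x, l <= x <= r -> exists2 e : R, 0 < e & forall y,
     l <= y <= r -> `|y - x| < e -> f y = f x) ->
  f l = f r.
Proof.
move=> lr loc; apply: (@cousin (fun a b => f a = f b) l r) => //.
- move=> x xlr; have [e e0 H] := loc x xlr; exists e => // a b la ax xb br ab.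
  move/andP: xlr => [lx xr].
  rewrite (H a) ?(H b)//.
  + by rewrite br (le_trans lx).
  + by rewrite ger0_norm ?subr_ge0// (le_lt_trans _ ab)// lerB.
  + by rewrite la (le_trans ax).
  + by rewrite distrC ger0_norm ?subr_ge0// (le_lt_trans _ ab)// lerB.
- by move=> a b c _ _ _ _ ->.
Qed.

End Cousin.

(** * Triviality of local cocycles on simply connected sets *)

Section Cocycle.
Context {R : realType} {V : normedModType R} (D : set V) (I : V -> V -> R).

(** I is an additive cocycle near each point of D: an Alexander-Spanier
    1-cocycle. *)
Definition local_cocycle := forall c, D c -> exists2 e : R, 0 < e &
  forall x y z, `|x - c| < e -> `|y - c| < e -> `|z - c| < e ->
    I x y + I y z = I x z.

Hypothesis cocI : local_cocycle.

Lemma cocycle_diag x : D x -> I x x = 0.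
Proof.
move=> /cocI[e e0 H].
have := H x x x; rewrite subrr normr0 => /(_ e0 e0 e0).
by rewrite -[RHS]addr0 => /addrI.
Qed.

(** Phi is a lift of K on the rectangle [a, b] x [c, d]: near each point, its
    increments are the values of the cocycle along K. *)
Definition lift2 (K : R * R -> V) (a b c d : R) (Phi : R -> R -> R) :=
  forall s t, a <= s <= b -> c <= t <= d -> exists2 e : R, 0 < e &
    forall s' t', a <= s' <= b -> c <= t' <= d -> `|s' - s| < e ->
      `|t' - t| < e -> Phi s' t' - Phi s t = I (K (s, t)) (K (s', t')).

Definition liftable (K : R * R -> V) a b c d := exists Phi, lift2 K a b c d Phi.

Lemma liftable_swap (K : R * R -> V) a b c d :
  liftable (fun z => K (z.2, z.1)) c d a b -> liftable K a b c d.
Proof.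
move=> [Phi H]; exists (fun s t => Phi t s) => s t sab tcd.
have [e e0 He] := H t s tcd sab; exists e => // s' t' s'ab t'cd ss' tt'.
exact: He.
Qed.

Lemma continuous_near (K : R * R -> V) s t (e : R) : continuous K -> 0 < e ->
  exists2 d : R, 0 < d & forall s' t', `|s' - s| < d -> `|t' - t| < d ->
    `|K (s', t') - K (s, t)| < e.
Proof.
move=> cK e0; have /cvgrPdist_lt/(_ _ e0) := cK (s, t).
move/near_normP => [d d0 H]; exists d => // s' t' ss tt.
by rewrite distrC; apply: H; rewrite /Num.norm/= gt_max ss tt.
Qed.

(** On a rectangle that K sends into a ball where the cocycle relation holds,
    a lift is given by the cocycle based at the centre of the ball. *)
Lemma liftable_small (K : R * R -> V) s t : continuous K -> D (K (s, t)) ->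
  exists2 e : R, 0 < e & forall a b c d, a <= s -> s <= b -> c <= t -> t <= d ->
    b - a < e -> d - c < e -> liftable K a b c d.
Proof.
move=> cK DK; have [e e0 He] := cocI DK.
have [r r0 Hr] := continuous_near s t cK e0.
exists r => // a b c d asl sb ct td ba dc.
have Q s' t' : a <= s' <= b -> c <= t' <= d -> `|K (s', t') - K (s, t)| < e.
  move=> /andP[s1 s2] /andP[t1 t2].
  by apply: Hr; rewrite ltr_distlC; apply/andP; split; lra.
exists (fun s' t' => I (K (s, t)) (K (s', t'))) => s1 t1 s1ab t1cd.
exists 1 => // s2 t2 s2ab t2cd _ _.
have ee : `|K (s, t) - K (s, t)| < e by rewrite subrr normr0.
by rewrite -(He _ _ _ ee (Q _ _ s1ab t1cd) (Q _ _ s2ab t2cd)) addrC addKr.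
Qed.

(** Lifts on two rectangles with a common edge differ by a constant on that
    edge, hence can be glued after subtraction of the constant. *)
Lemma liftable_glue (K : R * R -> V) a b c d f : a <= b -> c <= d -> d <= f ->
  liftable K a b c d -> liftable K a b d f -> liftable K a b c f.
Proof.
move=> ab cd df [P1 H1] [P2 H2].
have dcd : c <= d <= d by rewrite cd lexx.
have ddf : d <= d <= f by rewrite df lexx.
pose k := P1 a d - P2 a d.
have edge s : a <= s <= b -> P1 s d - P2 s d = k.
  move=> /andP[as_ sb]; apply/esym.
  apply: (@locally_constant _ (fun s => P1 s d - P2 s d)) => // x /andP[ax xs].
  have xab : a <= x <= b by rewrite ax (le_trans xs).
  have [e1 e10 He1] := H1 _ _ xab dcd.
  have [e2 e20 He2] := H2 _ _ xab ddf.
  exists (Num.min e1 e2) => [|y /andP[ay ys]]; first by rewrite lt_min e10.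
  have yab : a <= y <= b by rewrite ay (le_trans ys).
  rewrite lt_min => /andP[y1 y2].
  have E1 := He1 y d yab dcd y1; rewrite subrr normr0 in E1.
  have E2 := He2 y d yab ddf y2; rewrite subrr normr0 in E2.
  by have := E1 e10; have := E2 e20; lra.
exists (fun s t => if t <= d then P1 s t else P2 s t + k) => s t sab /andP[ct tf].
have [td|dt|td] := ltgtP t d.
- have [|e e0 He] := H1 s t sab; first by rewrite ct ltW.
  exists (Num.min e (d - t)); first by rewrite lt_min e0 subr_gt0.
  move=> s' t' s'ab /andP[ct' t'f]; rewrite !lt_min => /andP[ss _] /andP[tt tt'].
  have t'd : t' <= d by move: tt'; rewrite ltr_distlC; lra.
  by rewrite t'd; apply: He => //; rewrite ct'.
- have [|e e0 He] := H2 s t sab; first by rewrite tf ltW.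
  exists (Num.min e (t - d)); first by rewrite lt_min e0 subr_gt0.
  move=> s' t' s'ab /andP[ct' t'f]; rewrite !lt_min => /andP[ss _] /andP[tt tt'].
  have t'd : d < t' by move: tt'; rewrite ltr_distlC; lra.
  rewrite leNgt t'd /= opprD addrACA subrr addr0; apply: He => //.
  by rewrite t'f ltW.
- rewrite td.
  have [e1 e10 He1] := H1 _ _ sab dcd.
  have [e2 e20 He2] := H2 _ _ sab ddf.
  exists (Num.min e1 e2); first by rewrite lt_min e10.
  move=> s' t' s'ab /andP[ct' t'f]; rewrite !lt_min => /andP[s1 s2] /andP[t1 t2].
  have [t'd|t'd] := leP t' d; first by apply: He1 => //; rewrite ct'.
  rewrite -(edge _ sab).
  rewrite [X in X = _](_ : _ = P2 s' t' - P2 s d); last by ring.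
  by apply: He2 => //; rewrite t'f ltW.
Qed.

(** The lemma of Cousin is applied in each of the two variables in turn: for a
    fixed s, to strips of small width around s, then to full strips. *)
Lemma liftable_rect (K : R * R -> V) a b c d : continuous K ->
  (forall z, D (K z)) -> a <= b -> c <= d -> liftable K a b c d.
Proof.
move=> cK DK ab cd.
apply: (@cousin _ (fun a b => liftable K a b c d)) => //; last first.
  move=> a1 a2 a3 _ a12 a23 _ l1 l2; apply: liftable_swap.
  by apply: (@liftable_glue _ _ _ _ a2) => //; exact: liftable_swap.
move=> s sab.
pose P c d := exists2 e : R, 0 < e & forall a b, a <= s -> s <= b -> b - a < e ->
  liftable K a b c d.
suff [e e0 He] : P c d by exists e => // a' b' _ as_ sb _; exact: He.
apply: (@cousin _ P) => //.
- move=> t tcd; have [e e0 He] := liftable_small cK (DK (s, t)).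
  exists e => // c' d' _ ct td _ cd'.
  by exists e => // a' b' as_ sb ab'; apply: He.
- move=> c1 c2 c3 _ c12 c23 _ [e1 e10 H1] [e2 e20 H2].
  exists (Num.min e1 e2) => [|a' b' as_ sb]; first by rewrite lt_min e10.
  rewrite lt_min => /andP[ab1 ab2].
  apply: (@liftable_glue _ _ _ _ c2) => //; first exact: le_trans sb.
  + exact: H1.
  + exact: H2.
Qed.

(** One-dimensional lifts, over the parameter interval [0, 1]. *)
Definition lift (p : R -> V) (phi : R -> R) :=
  forall t, 0 <= t <= 1 -> exists2 e : R, 0 < e &
    forall t', 0 <= t' <= 1 -> `|t' - t| < e -> phi t' - phi t = I (p t) (p t').

Lemma lift_exists p : continuous p -> (forall t, D (p t)) -> exists phi, lift p phi.
Proof.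
move=> cp Dp.
have [||||Phi H] := @liftable_rect (fun z => p z.2) 0 1 0 1 => //.
  by move=> z; apply: continuous_comp; [exact: cvg_snd|exact: cp].
have s01 : 0 <= (0 : R) <= 1 by rewrite lexx ler01.
exists (Phi 0) => t t01; have [e e0 He] := H 0 t s01 t01.
by exists e => // t' t'01 tt'; rewrite He// subrr normr0.
Qed.

(** The total increment of a lift depends on the path only. *)
Lemma lift_unique p phi psi : lift p phi -> lift p psi ->
  phi 1 - phi 0 = psi 1 - psi 0.
Proof.
move=> H1 H2.
suff : phi 0 - psi 0 = phi 1 - psi 1 by lra.
apply: (@locally_constant _ (fun t => phi t - psi t)) => // x x01.
have [e1 e10 He1] := H1 x x01; have [e2 e20 He2] := H2 x x01.
exists (Num.min e1 e2) => [|y y01]; first by rewrite lt_min e10.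
rewrite lt_min => /andP[y1 y2].
by have := He1 y y01 y1; have := He2 y y01 y2; lra.
Qed.

Lemma lift_const p phi c : D c -> (forall t, 0 <= t <= 1 -> p t = c) ->
  lift p phi -> phi 1 = phi 0.
Proof.
move=> Dc pc H; apply/eqP; rewrite -subr_eq0; apply/eqP.
rewrite (lift_unique H (_ : lift p (fun=> 0))) ?subrr// => t t01.
by exists 1 => // t' t'01 _; rewrite !pc// cocycle_diag// subrr.
Qed.

Lemma lift_affine p q phi (a b : R) : `|b| <= 1 -> 0 <= a <= 1 -> 0 <= a + b <= 1 ->
  (forall t, 0 <= t <= 1 -> p (a + t * b) = q t) -> lift p phi ->
  lift q (fun t => phi (a + t * b)).
Proof.
move=> b1 a01 ab01 pq H.
have f01 t : 0 <= t <= 1 -> 0 <= a + t * b <= 1.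
  by move=> t01; apply/andP; split; nra.
move=> t t01; have [e e0 He] := H _ (f01 t t01).
exists e => // t' t'01 tt'; rewrite -!pq//; apply: He; first exact: f01.
rewrite opprD addrACA subrr add0r -mulrBl normrM.
by rewrite (le_lt_trans _ tt')// ler_piMr.
Qed.

(** The retraction of the line onto [0, 1]; precomposition with it extends paths
    and homotopies to globally continuous maps with values in D. *)
Definition clamp (t : R) : R := Num.max 0 (Num.min t 1).

Lemma clamp01 t : 0 <= clamp t <= 1.
Proof. by rewrite /clamp le_max lexx/= ge_max ler01 ge_min lexx orbT. Qed.

Lemma clamp_id t : 0 <= t <= 1 -> clamp t = t.
Proof. by move=> /andP[t0 t1]; rewrite /clamp min_l// max_r. Qed.

Lemma clamp_le0 t : t <= 0 -> clamp t = 0.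
Proof. by move=> t0; rewrite /clamp max_l// ge_min t0. Qed.

Lemma clamp_ge1 t : 1 <= t -> clamp t = 1.
Proof. by move=> t1; rewrite /clamp min_r// max_r. Qed.

Lemma clamp_lip s t : `|clamp s - clamp t| <= `|s - t|.
Proof.
wlog st : s t / s <= t.
  move=> H; have [/H//|/ltW/H] := leP s t.
  by rewrite distrC (distrC t).
rewrite (distrC s) (distrC (clamp s)) (@ger0_norm _ (t - s)) ?subr_ge0//.
have clampP x : [\/ x <= 0 /\ clamp x = 0, 1 <= x /\ clamp x = 1 |
    0 <= x <= 1 /\ clamp x = x].
  have [x0|x0] := leP x 0; first by constructor 1; rewrite clamp_le0.
  have [x1|x1] := leP 1 x; first by constructor 2; rewrite clamp_ge1.
  by constructor 3; rewrite clamp_id ?ltW.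
rewrite ler_norml.
by case: (clampP s) => -[Hs ->]; case: (clampP t) => -[Ht ->]; lra.
Qed.

Lemma clamp_continuous : continuous clamp.
Proof.
move=> t; apply/cvgrPdist_lt => e e0.
apply: (@norm_nearP _ R^o _ _ _ e0) => s ts; rewrite distrC.
exact: le_lt_trans (clamp_lip _ _) ts.
Qed.

Lemma path_clamp (p : R -> V) : path_in D p ->
  continuous (p \o clamp) /\ forall t, D ((p \o clamp) t).
Proof.
move=> [cp Dp]; split=> [t|t]; last first.
  by apply: Dp; exists (clamp t) => //=; rewrite in_itv/= clamp01.
move/subspace_continuousP: cp => cp.
apply/cvgrPdist_lt => e e0.
have cI : `[0, 1]%classic (clamp t) by rewrite /= in_itv/= clamp01.
have /cvgrPdist_lt/(_ _ e0) := cp _ cI.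
rewrite near_withinE => /near_normP[d d0 H].
apply: (@norm_nearP _ R^o _ _ _ d0) => s ts.
apply: H; last by rewrite /= in_itv/= clamp01.
exact: le_lt_trans (clamp_lip _ _) ts.
Qed.

Lemma square_clamp (K : R * R -> V) :
  {within `[0, 1] `*` `[0, 1], continuous K} ->
  K @` (`[0, 1] `*` `[0, 1]) `<=` D ->
  continuous (fun z => K (clamp z.1, clamp z.2)) /\
  forall z, D (K (clamp z.1, clamp z.2)).
Proof.
move=> cK DK.
have cI (z : R * R) : (`[0, 1] `*` `[0, 1])%classic (clamp z.1, clamp z.2).
  by split; rewrite /= in_itv/= clamp01.
split=> [z|z]; last by apply: DK; exists (clamp z.1, clamp z.2).
move/subspace_continuousP: cK => cK.
apply/cvgrPdist_lt => e e0.
have /cvgrPdist_lt/(_ _ e0) := cK _ (cI z).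
rewrite near_withinE => /near_normP[d d0 H].
apply: (@norm_nearP _ (R^o * R^o)%type _ _ _ d0) => s zs; apply: H; last exact: cI.
move: zs; rewrite /Num.norm/= !gt_max => /andP[z1 z2].
by rewrite !(le_lt_trans (clamp_lip _ _)).
Qed.

(** Null-homotopic loops have no holonomy: the lift of the homotopy is constant
    on the three sides of the square that are sent to the base point. *)
Lemma null_homotopic_lift p phi : null_homotopic D p -> D (p 0) ->
  lift p phi -> phi 1 = phi 0.
Proof.
move=> [K [cK DK K01 K0]] Dp0 Hphi.
have [cK' DK'] := square_clamp cK DK.
have [||||Phi H] := @liftable_rect (fun z => K (clamp z.1, clamp z.2)) 0 1 0 1 => //.
have i0 : 0 <= (0 : R) <= 1 by rewrite lexx ler01.
have i1 : 0 <= (1 : R) <= 1 by rewrite lexx ler01.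
have hlift s : 0 <= s <= 1 -> lift (fun t => K (s, clamp t)) (Phi s).
  move=> s01 t t01; have [e e0 He] := H s t s01 t01.
  exists e => // t' t'01 tt'.
  by rewrite He// ?subrr ?normr0//= (clamp_id s01).
have vlift t : 0 <= t <= 1 -> lift (fun s => K (clamp s, t)) (Phi^~ t).
  move=> t01 s s01; have [e e0 He] := H s t s01 t01.
  exists e => // s' s'01 ss'.
  by rewrite He// ?subrr ?normr0//= (clamp_id t01).
have E0 : lift p (Phi 0).
  move=> t t01; have [e e0 He] := hlift 0 i0 t t01; exists e => // t' t'01 tt'.
  by rewrite He// !clamp_id// !(K01 _ _).1.
have E1 : Phi 1 1 = Phi 1 0.
  apply: lift_const Dp0 _ (hlift 1 i1) => t t01.
  by rewrite clamp_id// (K01 _ t01).2.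
have E2 : Phi 1 0 = Phi 0 0.
  apply: lift_const Dp0 _ (vlift 0 i0) => s s01.
  by rewrite clamp_id// (K0 _ s01).1.
have E3 : Phi 1 1 = Phi 0 1.
  apply: lift_const Dp0 _ (vlift 1 i1) => s s01.
  by rewrite clamp_id// (K0 _ s01).2.
have := lift_unique Hphi E0; lra.
Qed.

(** On a simply connected open set every local cocycle is a coboundary.  The
    value v x is the holonomy along some path from x0 to x. *)
Lemma cocycle_trivial : open D -> simply_connected R D ->
  exists v : V -> R, forall c, D c -> exists2 e : R, 0 < e &
    forall y, `|y - c| < e -> v y - v c = I c y.
Proof.
move=> oD [pcD scD].
have [[x0 Dx0]|D0] := pselect (exists x, D x); last first.
  by exists (fun=> 0) => c Dc; exfalso; apply: D0; exists c.
have /boolp.choice[v vP] : forall x, exists vx : R, D x ->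
    exists (p : R -> V) (phi : R -> R),
    [/\ continuous p, forall t, D (p t), p 0 = x0 & p 1 = x] /\
    lift p phi /\ vx = phi 1 - phi 0.
  move=> x; have [Dx|nDx] := pselect (D x); last by exists 0.
  have [p [/path_clamp[cp Dp] p0 p1]] := pcD _ _ Dx0 Dx.
  have [phi Hphi] := lift_exists cp Dp.
  exists (phi 1 - phi 0) => _; exists (p \o clamp), phi; split=> //; split=> //=.
  - by rewrite clamp_id ?lexx ?ler01.
  - by rewrite clamp_id ?lexx ?ler01.
exists v => c Dc.
have [p [phi [[cp Dp p0 p1] [Hp vc]]]] := vP _ Dc.
have [e1 e10 He1] := cocI Dc.
have [e2 e20 He2] : exists2 e : R, 0 < e & forall y, `|y - c| < e -> D y.
  by apply: near_normP; exact: open_nbhs_nbhs.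
exists (Num.min e1 e2) => [|y]; first by rewrite lt_min e10.
rewrite lt_min => /andP[y1 y2].
have [q [psi [[cq Dq q0 q1] [Hq vy]]]] := vP _ (He2 _ y2).
have seg1 t : 0 <= t <= 1 -> `|c + t *: (y - c) - c| <= `|y - c|.
  move=> /andP[t0 t1]; rewrite addrC addKr normrZ ger0_norm//.
  by rewrite ler_piMl.
(* L runs through p, then the segment from c to y, then q backwards, each on
   a third of [0, 1].  Written as a sum in which every term is constant outside
   its own third, it is visibly continuous. *)
pose L t := p (clamp (3 * t)) + clamp (3 * t - 1) *: (y - c)
            + (q (1 - clamp (3 * t - 2)) - y).
have L1 t : 3 * t <= 1 -> L t = p (clamp (3 * t)).
  move=> t3; rewrite /L (@clamp_le0 (3 * t - 1)) ?subr_le0//.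
  rewrite (@clamp_le0 (3 * t - 2)); last by lra.
  by rewrite scale0r subr0 q1 subrr !addr0.
have L2 t : 1 <= 3 * t <= 2 -> L t = c + (3 * t - 1) *: (y - c).
  move=> /andP[t1 t2]; rewrite /L (@clamp_ge1 (3 * t))// p1.
  rewrite (@clamp_id (3 * t - 1)); last by apply/andP; split; lra.
  by rewrite (@clamp_le0 (3 * t - 2)) ?subr_le0// subr0 q1 subrr addr0.
have L3 t : 2 <= 3 * t -> L t = q (1 - clamp (3 * t - 2)).
  move=> t2; rewrite /L (@clamp_ge1 (3 * t)); last by lra.
  rewrite p1 (@clamp_ge1 (3 * t - 1)); last by lra.
  by rewrite scale1r (addrC c) subrK (addrC y) subrK.
have DL t : D (L t).
  have [/L1->|t1] := leP (3 * t) 1; first exact: Dp.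
  have [t2|/ltW/L3->] := leP (3 * t) 2; last exact: Dq.
  rewrite L2 ?(ltW t1)//; apply: He2; apply: le_lt_trans y2; apply: seg1.
  by apply/andP; split; lra.
have caff (a b : R) : continuous (fun t : R => clamp (a * t - b)).
  move=> t; apply: (@continuous_comp _ _ _ (fun t : R => a * t - b) clamp);
    last exact: clamp_continuous.
  apply: cvgB; last exact: cvg_cst.
  by apply: cvgM; [exact: cvg_cst|exact: cvg_id].
have cL : continuous L.
  move=> t; apply: cvgD; first apply: cvgD.
  - apply: (@continuous_comp _ _ _ (fun t : R => clamp (3 * t)) p);
      last exact: cp.
    by have := caff 3 0 t; under eq_fun do rewrite subr0.
  - by apply: cvgZr_tmp; exact: caff.
  - apply: cvgB; last exact: cvg_cst.
    apply: (@continuous_comp _ _ _ (fun t : R => 1 - clamp (3 * t - 2)) q);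
      last exact: cq.
    by apply: cvgB; [exact: cvg_cst|exact: caff].
have L0 : L 0 = x0 by rewrite L1 ?mulr0// clamp_le0.
have Lend : L 1 = x0 by rewrite L3 ?mulr1 ?clamp_ge1 ?subrr//; lra.
have [phL HL] := lift_exists cL DL.
have loop : phL 1 = phL 0.
  apply: null_homotopic_lift HL => //.
  apply: scD; last by rewrite L0 Lend.
  split; last by move=> _ [t _ <-].
  exact: continuous_subspaceT.
have i3 : `|3^-1 : R| <= 1 by rewrite ger0_norm ?invr_ge0//; lra.
have A1 : lift p (fun t => phL (0 + t * 3^-1)).
  apply: lift_affine HL => //; try by apply/andP; split; lra.
  move=> t t01; have E : 3 * (t * 3^-1) = t by field.
  by rewrite add0r L1 E ?clamp_id//; case/andP: t01.
have A3 : lift q (fun t => phL (1 + t * - 3^-1)).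
  apply: lift_affine HL => //; try by apply/andP; split; lra.
    by rewrite normrN.
  move=> t t01; rewrite L3; last by lra.
  by congr q; rewrite clamp_id; [field|apply/andP; split; lra].
have A2 : lift (fun t => c + t *: (y - c)) (fun t => phL (3^-1 + t * 3^-1)).
  apply: lift_affine HL => //; try by apply/andP; split; lra.
  move=> t t01; rewrite L2; last by apply/andP; split; lra.
  by congr (_ + _ *: _); field.
have A2' : lift (fun t => c + t *: (y - c)) (fun t => I c (c + t *: (y - c))).
  move=> t t01; exists 1 => // t' t'01 _.
  have b (u : R) : 0 <= u <= 1 -> `|c + u *: (y - c) - c| < e1.
    by move=> u01; apply: le_lt_trans y1; exact: seg1.
  have cc : `|c - c| < e1 by rewrite subrr normr0.
  by rewrite -(He1 _ _ _ cc (b t t01) (b t' t'01)) addrC addKr.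
have U1 := lift_unique Hp A1.
have U2 := lift_unique A2' A2.
have U3 := lift_unique Hq A3.
move: U1 U2 U3; rewrite !mul1r !mul0r !addr0 scale1r scale0r addr0 add0r.
rewrite (addrC c) subrK cocycle_diag// vc vy => -> U2 ->.
have -> : 1 - 3^-1 = 3^-1 + 3^-1 :> R by field.
by rewrite loop; lra.
Qed.

End Cocycle.

(** * Exactness of closed 1-forms *)

Section LocalPoincare.
Context {R : realType} {n : nat} (D : set 'rV[R]_n).
Hypothesis oD : open D.
Variable w : 'I_n -> 'rV[R]_n -> R.
Hypothesis sw : forall i, smooth_on D (w i).
Hypothesis cw : forall i j r, D r -> partial j (w i) r = partial i (w j) r.

Notation mu := (@lebesgue_measure R).

(** The integrand of the 1-form (w_i) along the line t |-> x + t u. *)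
Definition line_form (x u : 'rV[R]_n) (t : R) : R :=
  \sum_i w i (x + t *: u) * u 0 i.

(** The integral of the 1-form along the segment from x to y. *)
Definition segment_integral (x y : 'rV[R]_n) : R :=
  (\int[mu]_(t in `[0%R, 1%R]) line_form x (y - x) t)%R.

Lemma continuous_line (g : 'rV[R]_n -> R) x u (t : R) :
  {for x + t *: u, continuous g} -> {for t, continuous (fun s : R => g (x + s *: u))}.
Proof.
move=> cg; apply: (@continuous_comp _ _ _ (fun s : R => x + s *: u) g) => //.
apply: cvgD; first exact: cvg_cst.
by apply: cvgZr_tmp; exact: cvg_id.
Qed.

Lemma integrable_segment (f : R -> R) :
  (forall t, 0 <= t <= 1 -> {for t, continuous f}) ->
  mu.-integrable `[0%R, 1%R] (EFin \o f).
Proof.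
move=> cf; apply: continuous_compact_integrable; first exact: segment_compact.
by apply: continuous_in_subspaceT => t; rewrite inE/= in_itv/= => /cf.
Qed.

Lemma line_form_continuous x u (t : R) : D (x + t *: u) ->
  {for t, continuous (line_form x u)}.
Proof.
move=> Dt; rewrite /prop_for /continuous_at /line_form.
apply: (@cvg_big R _ +%R 0 xpredT (@add_continuous R^o) R (nbhs t)) => i _.
apply: cvgM; last exact: cvg_cst.
exact: continuous_line (smooth_continuous (sw i) Dt).
Qed.

Lemma local_bounds c : D c -> exists e M : R, [/\ 0 < e, 0 <= M &
  forall r, `|r - c| < e -> [/\ D r, forall i, `|w i r| <= M &
    forall i j, `|partial j (w i) r| <= M]].
Proof.
move=> Dc.
pose M := \sum_i `|w i c| + \sum_(p : 'I_n * 'I_n) `|partial p.2 (w p.1) c| + 1.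
have S1 : 0 <= \sum_i `|w i c| by apply: sumr_ge0.
have S2 : 0 <= \sum_(p : 'I_n * 'I_n) `|partial p.2 (w p.1) c| by apply: sumr_ge0.
have M0 : 0 <= M by rewrite /M; lra.
have bnd (f : 'rV[R]_n -> R) : {for c, continuous f} -> `|f c| + 1 <= M ->
    \forall r \near c, `|f r| <= M.
  move=> /cvgrPdist_lt/(_ _ ltr01) nf fM; apply: filterS nf => r.
  rewrite distrC => fr; apply: le_trans fM.
  by rewrite -[f r](subrK (f c)) (le_trans (ler_normD _ _))// addrC lerD2l ltW.
have n1 : \forall r \near c, forall i, `|w i r| <= M.
  apply: (@filter_forall _ _ (fun i r => `|w i r| <= M) (nbhs c)) => i.
  apply: bnd; first exact: smooth_continuous (sw i) Dc.
  rewrite /M lerD2r (bigD1 i)//= -addrA lerDl addr_ge0//.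
  exact: sumr_ge0.
have n2 : \forall r \near c, forall p : 'I_n * 'I_n, `|partial p.2 (w p.1) r| <= M.
  apply: (@filter_forall _ _
    (fun (p : 'I_n * 'I_n) r => `|partial p.2 (w p.1) r| <= M) (nbhs c)) => p.
  apply: bnd; first exact: smooth_continuous (smooth_partial p.2 (sw p.1)) Dc.
  rewrite /M lerD2r [X in _ + X](bigD1 p)//= addrCA lerDl addr_ge0//.
  exact: sumr_ge0.
have [e e0 He] := near_normP (filter_and (open_near oD Dc) (filter_and n1 n2)).
exists e, M; split=> // r rc; have [Dr [r1 r2]] := He r rc; split=> // i j.
exact: (r2 (i, j)).
Qed.

(** In a ball where the form and its first derivatives are bounded, the integral
    along the segment from x is a primitive: the derivative is taken under the
    integral sign, and by closedness the resulting integrand df 0 is the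
    derivative of t |-> t w_j (x + t (y - x)). *)
Lemma segment_integral_derive c (e M : R) x y j : 0 <= M ->
  (forall r, `|r - c| < e -> [/\ D r, forall i, `|w i r| <= M &
    forall i j, `|partial j (w i) r| <= M]) ->
  `|x - c| < e -> `|y - c| < e ->
  is_derive y (delta_mx 0 j) (segment_integral x) (w j y).
Proof.
move=> M0 He xc yc; set v : 'rV[R]_n := delta_mx 0 j.
pose u (h : R) : 'rV[R]_n := h *: v + y - x.
pose f (h t : R) := line_form x (u h) t.
pose df (h t : R) := \sum_i (t * partial j (w i) (x + t *: u h) * u h 0 i
   + w i (x + t *: u h) * v 0 i).
pose d := e - `|y - c|.
have d0 : 0 < d by rewrite subr_gt0.
have nv : `|v| <= 1 := delta_norm_le1 j.
have yh (h : R) : h \in `]-d, d[ -> `|h *: v + y - c| < e.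
  rewrite in_itv/= => hd; have {hd}: `|h| < d by rewrite ltr_norml.
  move=> hd; rewrite -addrA (le_lt_trans (ler_normD _ _))// -ltrBrDr.
  apply: le_lt_trans hd; rewrite normrZ -[leRHS]mulr1.
  by rewrite ler_wpM2l.
have Bxy (h t : R) : h \in `]-d, d[ -> 0 <= t <= 1 -> `|x + t *: u h - c| < e.
  by move=> /yh yhe t01; exact: ball_convex.
have fd (h t : R) : h \in `]-d, d[ -> 0 <= t <= 1 -> is_derive h 1 (f^~ t) (df h t).
  move=> hd t01; have [Dr _ _] := He _ (Bxy h t hd t01).
  have -> : f^~ t = \sum_i (fun h => w i (x + t *: u h) * u h 0 i).
    by apply/funext => k; rewrite fct_sumE.
  apply: is_derive_sum => i; apply: deriv_mul.
    have E (s : R) : x + t *: u s = x + t *: (y - x) + s *: (t *: v).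
      by apply/rowP => k; rewrite !mxE; ring.
    under eq_fun do rewrite E.
    have dif := smooth_differentiable oD (sw i) Dr.
    rewrite E in Dr dif *.
    apply: (@is_derive_eq _ _ _ _ _ _ _ _
      (is_derive_line (diff_derivable dif))).
    rewrite derive_partials// (bigD1 j)//= big1 ?addr0 => [|k kj].
      by rewrite !mxE !eqxx mulr1.
    by rewrite !mxE eqxx (negbTE kj) mulr0 mul0r.
  have -> : (fun s => u s 0 i) = (fun s => s * v 0 i + (y - x) 0 i).
    by apply/funext => s; rewrite !mxE; ring.
  apply: (@is_derive_eq _ _ _ _ _ _ _ _
    (deriv_add (deriv_mul (is_derive_id h 1) (is_derive_cst (v 0 i) h 1))
               (is_derive_cst ((y - x) 0 i) h 1))).
  by rewrite mul1r mulr0 !addr0.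
have I0 : `]-d, d[%classic 0 by rewrite /= in_itv/= oppr_lt0 d0.
have intf (h : R) : `]-d, d[%classic h -> mu.-integrable `[0%R, 1%R] (EFin \o f h).
  move=> hd; apply: integrable_segment => t t01.
  by apply: line_form_continuous; have [] := He _ (Bxy h t hd t01).
(* A constant bound for the derivative in h: on the ball `|u h 0 i| is at most
   2 e. *)
pose G := \sum_(i < n) (M * (e + e) + M).
have e0 : 0 < e by rewrite (le_lt_trans _ xc).
have Gub (h t : R) : `]-d, d[%classic h -> `[0%R, 1%R]%classic t ->
    `|partial1of2 f h t| <= G.
  move=> hd; rewrite /= in_itv/= => t01.
  have [Dr wM pM] := He _ (Bxy h t hd t01).
  rewrite partial1of2E; have [_ ->] := fd h t hd t01.
  rewrite (le_trans (ler_norm_sum _ _ _))//; apply: ler_sum => i _.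
  rewrite (le_trans (ler_normD _ _))// lerD//; last first.
    rewrite normrM -[leRHS]mulr1 ler_pM//.
    by rewrite (le_trans (coord_le_norm _ _)).
  rewrite normrM ler_pM//.
    rewrite normrM -[leRHS]mul1r ler_pM//.
    by case/andP: t01 => t0 t1; rewrite ger0_norm.
  rewrite (le_trans (coord_le_norm _ _))//.
  have -> : u h = (h *: v + y - c) - (x - c) by rewrite opprB addrA subrK.
  rewrite (le_trans (ler_normB _ _))// lerD// ltW//.
  exact: yh.
have G0 : 0 <= G.
  by apply: sumr_ge0 => i _; rewrite addr_ge0// mulr_ge0// addr_ge0// ltW.
have der : h^-1 *: (segment_integral x (h *: v + y) - segment_integral x y)
    @[h --> (0 : R)^'] --> (\int[mu]_(t in `[0%R, 1%R]) df 0 t)%R.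
  have /= := @cvg_differentiation_under_integral R _ _ mu f `[0%R, 1%R]%classic
    (measurable_itv _) 0 (-d) d I0 intf _ (cst G) (fun=> G0) _ Gub.
  have -> : (\int[mu]_(t in `[0%R, 1%R]) (partial1of2 f) 0 t =
    \int[mu]_(t in `[0%R, 1%R]) df 0 t)%R.
    apply: eq_Rintegral => t; rewrite inE/= in_itv/= => t01.
    by rewrite partial1of2E; have [_ ->] := fd 0 t I0 t01.
  have -> : (fun h : R => h^-1 *: ((\int[mu]_(t in `[0%R, 1%R]) f (h + 0) t)%R -
    (\int[mu]_(t in `[0%R, 1%R]) f 0 t)%R)) = (fun h => h^-1 *:
      (segment_integral x (h *: v + y) - segment_integral x y)).
    apply/funext => h; rewrite addr0 /f /segment_integral /u.
    by rewrite scale0r add0r.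
  apply.
  - move=> h t hd; rewrite /= in_itv/= => t01.
    by have [] := fd h t hd t01.
  - by apply: integrable_segment => t _; exact: cst_continuous.
suff ftc : (\int[mu]_(t in `[0%R, 1%R]) df 0 t)%R = w j y.
  rewrite ftc in der.
  apply: DeriveDef; last exact: cvg_lim der.
  by apply/cvg_ex; exists (w j y).
pose g (t : R) : 'rV[R]_n := x + t *: (y - x).
have gB (t : R) : 0 <= t <= 1 -> D (g t).
  by move=> t01; have [] := He _ (ball_convex xc yc t01).
have u0 : u 0 = y - x by rewrite /u scale0r add0r.
pose H (t : R) := t * w j (g t).
have dH (t : R) : 0 <= t <= 1 -> is_derive t 1 H (df 0 t).
  move=> t01; have Dg := gB t t01.
  have dif := smooth_differentiable oD (sw j) Dg.
  apply: (@is_derive_eq _ _ _ _ _ _ _ _ (deriv_mul (is_derive_id t 1)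
    (is_derive_line (diff_derivable dif)))).
  rewrite mul1r derive_partials// /df u0 big_split/= addrC; congr (_ + _).
    rewrite (bigD1 j)//= big1 ?addr0 => [|k kj].
      by rewrite !mxE !eqxx mulr1.
    by rewrite !mxE eqxx (negbTE kj) mulr0.
  rewrite mulr_sumr; apply: eq_bigr => i _.
  by rewrite cw//; ring.
have cdf (t : R) : 0 <= t <= 1 -> {for t, continuous (df 0)}.
  move=> t01; have Dg := gB t t01.
  rewrite /prop_for /continuous_at /df u0.
  apply: (@cvg_big R _ +%R 0 xpredT (@add_continuous R^o) R (nbhs t)) => i _.
  apply: cvgD; apply: cvgM; try exact: cvg_cst.
    apply: cvgM; first exact: cvg_id.
    exact: continuous_line (smooth_continuous (smooth_partial j (sw i)) Dg).
  exact: continuous_line (smooth_continuous (sw i) Dg).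
have cH (t : R) : 0 <= t <= 1 -> {for t, continuous H}.
  move=> t01; apply/differentiable_continuous/derivable1_diffP.
  by have [] := dH t t01.
rewrite /Rintegral (@continuous_FTC2 _ (df 0) H 0 1)//=.
- by rewrite /H mul1r mul0r subr0 /g scale1r addrC subrK.
- by apply: continuous_in_subspaceT => t; rewrite inE/= in_itv/= => /cdf.
- split.
  + by move=> t; rewrite in_itv/= => /andP[t0 t1]; have [] := dH t; rewrite ?ltW.
  + by apply: cvg_at_right_filter; apply: cH; rewrite lexx ler01.
  + by apply: cvg_at_left_filter; apply: cH; rewrite lexx ler01.
- move=> t; rewrite in_itv/= => /andP[t0 t1]; rewrite derive1E.
  have t01 : 0 <= t <= 1 by rewrite !ltW.
  by have [_ ->] := dH t t01.
Qed.

Lemma segment_integral_diag x : segment_integral x x = 0.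
Proof.
rewrite /segment_integral (_ : line_form x (x - x) = cst 0).
  by rewrite Rintegral_cst//= mul0r.
apply/funext => t; rewrite /line_form big1// => i _.
by rewrite subrr mxE mulr0.
Qed.

Lemma segment_integral_cocycle : local_cocycle D segment_integral.
Proof.
move=> c Dc; have [e [M [e0 M0 He]]] := local_bounds Dc.
exists e => // x y z xc yc zc.
have dI p q : `|p - c| < e -> `|q - c| < e -> forall j,
    is_derive q (delta_mx 0 j) (segment_integral p) (w j q).
  by move=> pc qc j; exact: segment_integral_derive M0 He pc qc.
pose f q := segment_integral x q - segment_integral y q.
have df q : `|q - c| < e -> forall j, is_derive q (delta_mx 0 j) f 0.
  move=> qc j; apply: (@is_derive_eq _ _ _ _ _ _ _ _
    (deriv_sub (dI _ _ xc qc j) (dI _ _ yc qc j))).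
  by rewrite subrr.
have : f y = f z.
  apply: zero_partials_ball yc zc => // q qc; split; last first.
    by move=> i; have [_] := df q qc i.
  have nq : \forall p \near q, `|p - c| < e.
    have eq0 : 0 < e - `|q - c| by rewrite subr_gt0.
    apply: (norm_nearP eq0) => p; rewrite ltrBrDr => pq.
    by rewrite (le_lt_trans _ pq)// (le_trans _ (ler_normD _ _))// addrA subrK.
  apply: differentiable_partials.
    by apply: filterS nq => p pc i; have [] := df p pc i.
  move=> i; apply/(@cvgrPdist_lt _ _ _ (nbhs q)) => k k0.
  apply: (@filterS _ (nbhs q) _ _ _ _ nq) => p pc.
  have [_ E] := df p pc i; have [_ E'] := df q qc i.
  by rewrite /partial E E' subrr normr0.
by rewrite /f segment_integral_diag subr0 => ->; rewrite subrK.
Qed.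

(** A closed smooth 1-form on a simply connected open set is exact. *)
Lemma closed_form_exact : simply_connected R D ->
  exists2 v : 'rV[R]_n -> R, smooth_on D v &
    forall i r, D r -> partial i v r = w i r.
Proof.
move=> scD.
have [v Hv] := cocycle_trivial segment_integral_cocycle oD scD.
have dv r : D r -> forall i, is_derive r (delta_mx 0 i) v (w i r).
  move=> Dr i; have [e e0 He] := Hv r Dr.
  have [e' [M [e'0 M0 He']]] := local_bounds Dr.
  have rr : `|r - r| < e' by rewrite subrr normr0.
  apply: (@near_eq_is_derive _ _ _
    (fun y => segment_integral r y + v r)).
    by apply: (norm_nearP e0) => y /He <-; rewrite subrK.
  apply: (@is_derive_eq _ _ _ _ _ _ _ _ (deriv_add
    (segment_integral_derive i M0 He' rr rr)
    (is_derive_cst (v r) r (delta_mx 0 i)))).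
  by rewrite addr0.
have pv i r : D r -> partial i v r = w i r.
  by move=> Dr; have [_] := dv r Dr i.
exists v => //; apply: (@smooth_primitive _ _ _ oD v w) => //; last first.
  by move=> i r Dr; exact: dv.
move=> r Dr; apply/differentiable_continuous.
apply: (@differentiable_on _ _ _ oD) Dr => {}r Dr i.
  by have [] := dv r Dr i.
apply/(@cvgrPdist_lt _ _ _ (nbhs r)) => k k0.
have := smooth_continuous (sw i) Dr => /cvgrPdist_lt/(_ _ k0) nw.
apply: (@filterS _ (nbhs r) _ _ _ _ (filter_and nw (open_near oD Dr))) => p [].
by move=> wp Dp; rewrite !pv.
Qed.

End LocalPoincare.

(** * Conservation laws *)

Lemma partial_val {R : realType} {n : nat} (f : 'rV[R]_n -> R) i r d :
  is_derive r (delta_mx 0 i) f d -> partial i f r = d.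
Proof. by case. Qed.

Lemma partial_cst {R : realType} {n : nat} (k : R) (i : 'I_n) r :
  partial i (fun=> k) r = 0.
Proof. exact: derive_cst. Qed.

(* Unfolding these into limits only slows down the comparison of distinct
   partial derivatives. *)
Local Opaque partial smooth_on.

Section Laws.
Context {R : realType} {n : nat} (D : set 'rV[R]_n).
Hypothesis oD : open D.
Variable lam : 'I_n -> 'rV[R]_n -> R.
Hypothesis slam : forall i, smooth_on D (lam i).

(** The compatibility condition d_i (d_j f) = d_j (d_i f) of a conservation
    law. *)
Lemma law_compatible u f i j r : conservation_law D lam u f -> D r ->
  (lam j r - lam i r) * partial i (partial j u) r =
  partial j (lam i) r * partial i u r - partial i (lam j) r * partial j u r.
Proof.
move=> [su sf fu] Dr.
have E k l : partial k (partial l f) r =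
    partial k (lam l) r * partial l u r + lam l r * partial k (partial l u) r.
  rewrite (@partial_ext _ _ _ oD _ (fun r => lam l r * partial l u r)) //; last first.
    by move=> x; rewrite inE => Dx; exact: fu.
  rewrite (partial_val (deriv_mul (smooth_is_derive k (slam l) Dr)
    (smooth_is_derive k (smooth_partial l su) Dr)))//.
have := partialC oD i j sf Dr; rewrite !E (partialC oD j i su Dr) => H.
apply: (@addIr _ (partial i (lam j) r * partial j u r
  + lam i r * partial i (partial j u) r)).
transitivity (partial i (lam j) r * partial j u r
  + lam j r * partial i (partial j u) r); first by ring.
by rewrite H; ring.
Qed.

Hypothesis dlam : pairwise_distinct D lam.

Lemma law_mixed_partial u f i j r : conservation_law D lam u f -> D r -> i != j ->
  partial i (partial j u) r =
  acoef lam i j r * partial i u r + acoef lam j i r * partial j u r.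
Proof.
move=> cl Dr ij; have := law_compatible i j cl Dr.
have nz : lam j r - lam i r != 0 by rewrite subr_eq0 eq_sym dlam.
have nz' : lam i r - lam j r != 0 by rewrite subr_eq0 dlam.
move=> H; apply: (mulfI nz); rewrite H /acoef.
by field; rewrite nz nz'.
Qed.

Lemma smooth_acoef i j : i != j -> smooth_on D (acoef lam i j).
Proof.
move=> ij; apply: (smooth_div oD _ (smooth_partial j (slam i))
  (smooth_sub oD (slam j) (slam i))).
by move=> r Dr; rewrite subr_eq0 eq_sym dlam.
Qed.

End Laws.

(** * The transform of conservation laws *)

Section Reciprocal.
Context {R : realType} {n : nat} (D : set 'rV[R]_n).
Hypothesis oD : open D.
Variables (lam : 'I_n -> 'rV[R]_n -> R) (h g : 'rV[R]_n -> R) (al : 'I_n).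
Hypothesis slam : forall i, smooth_on D (lam i).
Hypothesis dlam : pairwise_distinct D lam.
Hypothesis hg_law : conservation_law D lam h g.
Hypothesis h_neq0 : forall r, D r -> h r != 0.
Hypothesis dh_neq0 : forall r, D r -> partial al h r != 0.
Hypothesis dg_neq0 : forall r, D r -> partial al g r != 0.
Hypothesis den_neq0 : forall i r, i != al -> D r ->
       partial al h r - acoef lam i al r * h r != 0.

Let p := partial al h.
Let sh : smooth_on D h. Proof. by case: hg_law. Qed.
Let sg : smooth_on D g. Proof. by case: hg_law. Qed.
Let sp : smooth_on D p. Proof. exact: smooth_partial. Qed.
Let gh i r : D r -> partial i g r = lam i r * partial i h r.
Proof. by case: hg_law => _ _; apply. Qed.
Let mu r := g r / h r.
Let smu : smooth_on D mu. Proof. exact (smooth_div oD h_neq0 sg sh). Qed.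

Let lam_al_neq0 r : D r -> lam al r != 0.
Proof.
move=> Dr; have := dg_neq0 Dr; rewrite gh// mulf_eq0 negb_or.
by case/andP.
Qed.

(** The weight c_i, with value 0 at i = al.  It measures how the new velocities
    deviate from mu = g / h. *)
Definition weight (i : 'I_n) : 'rV[R]_n -> R :=
  if i == al then fun=> 0
  else fun r => partial al h r / (partial al h r - acoef lam i al r * h r).

Let c := weight.

Lemma smooth_weight i : smooth_on D (weight i).
Proof.
rewrite /weight; case: eqVneq => [_|ia].
  by apply/smooth_CkP => // k; exact: Ck_cst.
apply: (smooth_div oD _ sp
  (smooth_sub oD sp (smooth_mul oD (smooth_acoef oD slam dlam ia) sh))).
by move=> r; exact: den_neq0.
Qed.

Lemma new_velocityE i r : D r ->
  new_velocity lam h g al i r = mu r + c i r * (lam i r - mu r).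
Proof.
move=> Dr; rewrite /new_velocity /c /weight /mu; case: eqVneq => [_|ia].
  by rewrite mul0r addr0.
by field; rewrite h_neq0// den_neq0.
Qed.

Lemma smooth_new_velocity i : smooth_on D (new_velocity lam h g al i).
Proof.
apply: (@smooth_ext _ _ _ oD (fun r => mu r + c i r * (lam i r - mu r))).
  by move=> r; rewrite inE => Dr; rewrite new_velocityE.
exact: (smooth_add oD smu
  (smooth_mul oD (smooth_weight i) (smooth_sub oD (slam i) smu))).
Qed.

Lemma partial_mu i r : D r ->
  partial i mu r = partial i h r / h r * (lam i r - mu r).
Proof.
move=> Dr.
have E := partial_val (deriv_div (h_neq0 Dr) (smooth_is_derive i sg Dr)
  (smooth_is_derive i sh Dr)).
rewrite -/mu in E; rewrite E gh// /mu.
by field; exact: h_neq0.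
Qed.

Lemma partial_new_velocity i j r : D r ->
  partial j (new_velocity lam h g al i) r =
  partial j mu r * (1 - c i r) + partial j (c i) r * (lam i r - mu r)
  + c i r * partial j (lam i) r.
Proof.
move=> Dr.
rewrite (@partial_ext _ _ _ oD _ (fun r => mu r + c i r * (lam i r - mu r)))//;
  last by move=> x; rewrite inE => Dx; rewrite new_velocityE.
rewrite (partial_val (deriv_add (smooth_is_derive j smu Dr)
  (deriv_mul (smooth_is_derive j (smooth_weight i) Dr)
    (deriv_sub (smooth_is_derive j (slam i) Dr) (smooth_is_derive j smu Dr))))).
by rewrite -/c; ring.
Qed.

Section Semihamiltonian.
Hypothesis semiham : semihamiltonian D lam.

(** A first-order system for the weights.  For i = al it is trivial, for j = al
    algebraic; for i, j != al it is the semihamiltonian condition on the triple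
    (i, al, j). *)
Lemma weight_equation i j r : D r -> i != j ->
  partial j (c i) r * c j r + c i r * (1 - c i r) * (partial j h r / h r)
  + c i r * (c i r - c j r) * acoef lam i j r = 0.
Proof.
move=> Dr ij; have h0 := h_neq0 Dr.
have [ia|ia] := eqVneq i al.
  rewrite /c /weight ia eqxx !mul0r !addr0.
  by rewrite partial_cst mul0r.
have qi := den_neq0 ia Dr.
have [ja|ja] := eqVneq j al.
  have cj : c j r = 0 by rewrite /c /weight ja eqxx.
  rewrite cj mulr0 add0r subr0 ja /c /weight (negbTE ia).
  by field; rewrite h0 qi.
have qj := den_neq0 ja Dr.
have di : partial j (c i) r =
    (partial j p r * (p r - acoef lam i al r * h r) - p r *
     (partial j p r - (partial j (acoef lam i al) r * h r +
        acoef lam i al r * partial j h r)))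
     / (p r - acoef lam i al r * h r) ^+ 2.
  rewrite /c /weight (negbTE ia).
  rewrite (partial_val (deriv_div
    (g := fun x => p x - acoef lam i al x * h x) qi (smooth_is_derive j sp Dr)
    (deriv_sub (smooth_is_derive j sp Dr)
      (deriv_mul (smooth_is_derive j (smooth_acoef oD slam dlam ia) Dr)
        (smooth_is_derive j sh Dr)))))//.
rewrite di (law_mixed_partial oD slam dlam hg_law Dr ja).
rewrite (semiham ia ij _ Dr); last by rewrite eq_sym.
rewrite /c /weight (negbTE ia) (negbTE ja) -/p.
by field; rewrite h0 qi qj.
Qed.

(** [weight_equation] in terms of the new velocities: this is the form that
    makes [quotient_form] closed. *)
Lemma weight_velocity i j r : D r -> i != j ->
  (partial j (c i) r + (1 - c i r) * (partial j h r / h r)) *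
    (new_velocity lam h g al i r - new_velocity lam h g al j r) =
  (c i r - c j r) * partial j (new_velocity lam h g al i) r.
Proof.
move=> Dr ij; have E := weight_equation Dr ij.
have A : partial j (lam i) r = acoef lam i j r * (lam j r - lam i r).
  by rewrite /acoef mulfVK// subr_eq0 eq_sym dlam.
rewrite partial_new_velocity// !new_velocityE// partial_mu// A.
apply/eqP; rewrite -subr_eq0; apply/eqP.
rewrite -[RHS](mulr0 (lam i r - lam j r)) -E.
by ring.
Qed.

Variables (U F : 'rV[R]_n -> R).
Hypothesis UF_law : conservation_law D (new_velocity lam h g al) U F.
Hypothesis dLam : pairwise_distinct D (new_velocity lam h g al).

Let sU : smooth_on D U. Proof. by case: UF_law. Qed.
Let sF : smooth_on D F. Proof. by case: UF_law. Qed.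

(** The 1-form that must be the differential of u / h if U = L_al(u). *)
Definition quotient_form (i : 'I_n) (r : 'rV[R]_n) : R :=
  c i r * partial i U r / h r - U r * partial i h r / h r ^+ 2.

Let sh2 : smooth_on D (fun r => h r ^+ 2).
Proof. exact: smooth_mul. Qed.

Lemma smooth_quotient_form i : smooth_on D (quotient_form i).
Proof.
apply: (smooth_sub oD
  (smooth_div oD h_neq0 (smooth_mul oD (smooth_weight i) (smooth_partial i sU)) sh)
  (smooth_div oD _ (smooth_mul oD sU (smooth_partial i sh)) sh2)).
by move=> r Dr; rewrite expf_neq0// h_neq0.
Qed.

Lemma partial_quotient_form i j r : D r -> partial j (quotient_form i) r =
  (partial j (c i) r * partial i U r + c i r * partial j (partial i U) r) / h r
  - c i r * partial i U r * partial j h r / h r ^+ 2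
  - (partial j U r * partial i h r + U r * partial j (partial i h) r) / h r ^+ 2
  + U r * partial i h r * (2 * partial j h r) / h r ^+ 3.
Proof.
move=> Dr; have h0 := h_neq0 Dr; have h20 : h r * h r != 0 by rewrite mulf_neq0.
have dh := smooth_is_derive j sh Dr.
rewrite (partial_val (deriv_sub
  (deriv_div h0 (deriv_mul (smooth_is_derive j (smooth_weight i) Dr)
     (smooth_is_derive j (smooth_partial i sU) Dr)) dh)
  (deriv_div (g := fun x => h x * h x) h20 (deriv_mul (smooth_is_derive j sU Dr)
     (smooth_is_derive j (smooth_partial i sh) Dr)) (deriv_mul dh dh)))).
rewrite -/c; move: (partial j (c i) r) (c i r) (partial i U r) (partial j U r)
  (partial j (partial i U) r) (partial i h r) (partial j h r)
  (partial j (partial i h) r) (U r) (h r) h0.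
by move=> *; field.
Qed.

Lemma quotient_form_closed i j r : D r ->
  partial j (quotient_form i) r = partial i (quotient_form j) r.
Proof.
move=> Dr; have h0 := h_neq0 Dr.
have [->//|ij] := eqVneq i j.
have Kij := weight_velocity Dr ij.
have ji : j != i by rewrite eq_sym.
have Kji := weight_velocity Dr ji.
have C := law_compatible oD smooth_new_velocity i j UF_law Dr.
have nz : new_velocity lam h g al i r - new_velocity lam h g al j r != 0.
  by rewrite subr_eq0 dLam.
apply: (mulfI nz); apply/eqP; rewrite -subr_eq0; apply/eqP.
rewrite !partial_quotient_form// (partialC oD j i sU Dr) (partialC oD j i sh Dr).
move: Kij Kji C.
set Li := new_velocity lam h g al i r; set Lj := new_velocity lam h g al j r.
set A := partial j (c i) r; set B := partial i (c j) r.
set X := partial i (partial j U) r.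
move=> Kij Kji C.
move: (partial i (partial j h) r) (partial i U r) (partial j U r) (partial i h r)
  (partial j h r) (partial j (new_velocity lam h g al i) r)
  (partial i (new_velocity lam h g al j) r) (c i r) (c j r) (U r) (h r) h0
  A B X Kij Kji C => hij Ui Uj hi hj dLi dLj ci cj u0 y y0 A B X Kij Kji C.
(* The difference of the two derivatives, times Li - Lj, regrouped so that the
   two instances of [weight_velocity] and the compatibility condition apply. *)
transitivity (((A + (1 - ci) * (hj / y)) * (Li - Lj) * Ui
  + (B + (1 - cj) * (hi / y)) * (Lj - Li) * Uj
  - (ci - cj) * ((Lj - Li) * X)) / y); first by field.
by rewrite Kij Kji C; field.
Qed.

(** A primitive v of the form yields a conservation law (u, f) of the original
    system whose transform is (U, F). *)
Lemma inverse_transform v : smooth_on D v ->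
  (forall i r, D r -> partial i v r = quotient_form i r) ->
  exists u f, conservation_law D lam u f /\
    forall r, D r -> U r = Ltransform al h u r /\ F r = Ltransform al g f r.
Proof.
move=> sv dv.
pose u r := h r * v r.
pose f r := F r + (g r * v r - mu r * U r).
have su : smooth_on D u := smooth_mul oD sh sv.
have sf : smooth_on D f := smooth_add oD sF
  (smooth_sub oD (smooth_mul oD sg sv) (smooth_mul oD smu sU)).
have du i r : D r -> partial i u r =
    partial i h r * v r + c i r * partial i U r - U r * partial i h r / h r.
  move=> Dr; have h0 := h_neq0 Dr.
  rewrite (partial_val (deriv_mul (smooth_is_derive i sh Dr) (smooth_is_derive i sv Dr))).
  by rewrite dv// /quotient_form; field.
have law : conservation_law D lam u f.
  split=> // i r Dr; have h0 := h_neq0 Dr; rewrite du//.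
  rewrite (partial_val (deriv_add (smooth_is_derive i sF Dr)
    (deriv_sub (deriv_mul (smooth_is_derive i sg Dr) (smooth_is_derive i sv Dr))
      (deriv_mul (smooth_is_derive i smu Dr) (smooth_is_derive i sU Dr))))).
  have [_ _ FU] := UF_law.
  rewrite FU// new_velocityE// dv// gh// partial_mu// /quotient_form /mu.
  by field.
exists u, f; split=> // r Dr.
have h0 := h_neq0 Dr; have p0 := dh_neq0 Dr; have l0 := lam_al_neq0 Dr.
have c0 : c al r = 0 by rewrite /c /weight eqxx.
rewrite /Ltransform; case: law => _ _ ->//; rewrite gh// du// c0 /f /u /mu.
by split; field; rewrite ?h0 ?p0 ?l0.
Qed.

End Semihamiltonian.

(** The transform of a conservation law is one of the new system. *)
Lemma transform_law u f U F : conservation_law D lam u f ->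
  (forall r, D r -> U r = Ltransform al h u r /\ F r = Ltransform al g f r) ->
  conservation_law D (new_velocity lam h g al) U F.
Proof.
move=> law UF; have [su sf fu] := law.
pose W r := partial al u r / p r.
have sW : smooth_on D W := smooth_div oD dh_neq0 (smooth_partial al su) sp.
have UE : {in D, (fun r => u r - h r * W r) =1 U}.
  move=> r; rewrite inE => Dr; have p0 := dh_neq0 Dr.
  by have [-> _] := UF r Dr; rewrite /Ltransform /W /p; field.
have FE : {in D, (fun r => f r - g r * W r) =1 F}.
  move=> r; rewrite inE => Dr; have p0 := dh_neq0 Dr; have l0 := lam_al_neq0 Dr.
  have [_ ->] := UF r Dr; rewrite /Ltransform /W /p gh// fu//.
  by field; rewrite p0 l0.
split.
- exact (smooth_ext oD UE (smooth_sub oD su (smooth_mul oD sh sW))).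
- exact (smooth_ext oD FE (smooth_sub oD sf (smooth_mul oD sg sW))).
move=> i r Dr; have h0 := h_neq0 Dr; have p0 := dh_neq0 Dr.
rewrite -(partial_ext oD i Dr UE) -(partial_ext oD i Dr FE).
rewrite (partial_val (deriv_sub (smooth_is_derive i sf Dr)
  (deriv_mul (smooth_is_derive i sg Dr) (smooth_is_derive i sW Dr)))).
rewrite (partial_val (deriv_sub (smooth_is_derive i su Dr)
  (deriv_mul (smooth_is_derive i sh Dr) (smooth_is_derive i sW Dr)))).
rewrite fu// gh//.
have [ia|ia] := eqVneq i al.
  rewrite /new_velocity ia eqxx {1 3}/W -/p.
  by field; rewrite p0 h0.
have WE : partial i W r = (partial i (partial al u) r * p r
    - partial al u r * partial i p r) / p r ^+ 2.
  by rewrite (partial_val (deriv_div p0 (smooth_is_derive i (smooth_partial al su) Dr)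
    (smooth_is_derive i sp Dr))).
have qi := den_neq0 ia Dr.
rewrite WE (law_mixed_partial oD slam dlam law Dr ia).
rewrite (law_mixed_partial oD slam dlam hg_law Dr ia) /W.
rewrite /new_velocity (negbTE ia) -/p.
by field; rewrite p0 qi.
Qed.

End Reciprocal.

Theorem theorem2 (R : realType) (n : nat) (D : set 'rV[R]_n)
    (lam : 'I_n -> 'rV[R]_n -> R) (h g : 'rV[R]_n -> R) (al : 'I_n)
    (D_open : open D)
    (D_sc : simply_connected R D)
    (lam_smooth : forall i, smooth_on D (lam i))
    (lam_distinct : pairwise_distinct D lam)
    (lam_semiham : semihamiltonian D lam)
    (hg_law : conservation_law D lam h g)
    (h_neq0 : forall r, D r -> h r != 0)
    (dh_neq0 : forall r, D r -> partial al h r != 0)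
    (dg_neq0 : forall r, D r -> partial al g r != 0)
    (den_neq0 : forall i r, i != al -> D r ->
       partial al h r - acoef lam i al r * h r != 0)
    (Lam_distinct : pairwise_distinct D (new_velocity lam h g al)) :
  forall U F : 'rV[R]_n -> R,
    conservation_law D (new_velocity lam h g al) U F <->
    exists u f : 'rV[R]_n -> R,
      conservation_law D lam u f /\
      forall r, D r -> U r = Ltransform al h u r /\ F r = Ltransform al g f r.
Proof.
move=> U F; split=> [UF|[u [f [uf UFE]]]].
- have sw i := smooth_quotient_form D_open lam_smooth lam_distinct hg_law
    h_neq0 den_neq0 UF i.
  have cw i j r (Dr : D r) := quotient_form_closed D_open lam_smooth lam_distinct
    hg_law h_neq0 den_neq0 lam_semiham UF Lam_distinct i j Dr.
  have [v sv dv] := closed_form_exact D_open sw cw D_sc.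
  exact (inverse_transform D_open hg_law h_neq0 dh_neq0 dg_neq0
    den_neq0 UF sv dv).
- exact (transform_law D_open lam_smooth lam_distinct hg_law h_neq0 dh_neq0
    dg_neq0 den_neq0 uf UFE).
Qed.
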